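(* Let $t$ be a real number with $0<t<1$ that is transcendental (over $\mathbb{Q}$), and consider a weighted model of walks in the quarter plane arising from one of the five step sets (S) described in the context. Then the generating series $Q(x,y,t)$ is $x$-differentially transcendental and $y$-differentially transcendental.
   Context: Weighted walks. Let $(d_{i,j})_{(i,j)\in\{-1,0,1\}^2}$ be a family of elements of $\mathbb{Q}\cap[0,1]$ with $\sum_{i,j}d_{i,j}=1$. A walk with $k$ steps in the quarter plane is a sequence $w_0=(0,0),w_1,\dots,w_k$ of points of $\mathbb{Z}_{\ge 0}^2$ with $w_{r}-w_{r-1}\in\{-1,0,1\}^2$ for all $r$; its weight is $\prod_{r=1}^k d_{w_r-w_{r-1}}$. Let $q_{i,j,k}$ be the sum of the weights of all walks with $k$ steps ending at $(i,j)$, and $Q(x,y,t)=\sum_{i,j,k\ge 0}q_{i,j,k}x^iy^jt^k$. For $|x|<1$, $|y|<1$, $0<t<1$ this series converges; for the fixed number $t$ it is regarded as a function (power series) of $x$ and $y$. Models arising from (S). The model of the walk is the set $\{(i,j)\in\{-1,0,1\}^2\setminus\{(0,0)\} : d_{i,j}\ne 0\}$. The weighted model arises from (S) if this set is one of the following five sets: $\{(-1,1),(0,1),(1,-1)\}$; $\{(-1,1),(1,1),(1,-1)\}$; $\{(-1,1),(0,1),(1,1),(1,-1)\}$; $\{(-1,1),(0,1),(1,1),(1,0),(1,-1)\}$; $\{(-1,1),(0,1),(1,0),(1,-1)\}$. ($d_{0,0}$ may be zero or nonzero.) Differential transcendence. $Q(x,y,t)$ is $x$-differentially algebraic if, seen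 as a function of $x$, it is a solution of some nonzero (possibly nonlinear) polynomial differential equation with coefficients in $\mathbb{Q}(x,y,t)$, i.e. there are $m\ge 0$ and a nonzero polynomial $P\in\mathbb{Q}(x,y,t)[Y_0,\dots,Y_m]$ with $P(Q,\partial_xQ,\dots,\partial_x^mQ)=0$. It is $x$-differentially transcendental otherwise. The notions for $y$ are defined in the same way with $\partial_y$. *)

(* Defs.v *)
From HB Require Import structures.
From mathcomp Require Import all_boot all_order all_algebra.
(* The notations of mpoly.v are incompatible with those of
   MathComp-Analysis, hence mpoly n R for {mpoly R[n]} below. *)
From mathcomp Require Import -(notations) mpoly.
From mathcomp Require Import boolp reals topology normedtype sequences.

Set Implicit Arguments.
Unset Strict Implicit.
Unset Printing Implicit Defensive.

Import Order.TTheory GRing.Theory Num.Theory.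
Import numFieldNormedType.Exports.

Local Open Scope ring_scope.

(** * Formal power series *)

Record fps (A : Type) : Type := FPS { fps_coef : nat -> A }.

Lemma fpsP (A : Type) (f g : fps A) :
  (forall n, fps_coef f n = fps_coef g n) -> f = g.
Proof. by case: f g => [f] [g] /= fg; congr FPS; apply/funext. Qed.

HB.instance Definition _ (A : Type) := gen_eqMixin (fps A).
HB.instance Definition _ (A : Type) := gen_choiceMixin (fps A).

Section FpsZmodule.
Context (A : zmodType).
Implicit Types f g h : fps A.

Definition fps_zero : fps A := FPS (fun _ => 0).
Definition fps_opp f : fps A := FPS (fun n => - fps_coef f n).
Definition fps_add f g : fps A := FPS (fun n => fps_coef f n + fps_coef g n).

Fact fps_addA : associative fps_add.
Proof. by move=> f g h; apply: fpsP => n /=; rewrite addrA. Qed.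
Fact fps_addC : commutative fps_add.
Proof. by move=> f g; apply: fpsP => n /=; rewrite addrC. Qed.
Fact fps_add0 : left_id fps_zero fps_add.
Proof. by move=> f; apply: fpsP => n /=; rewrite add0r. Qed.
Fact fps_addN : left_inverse fps_zero fps_opp fps_add.
Proof. by move=> f; apply: fpsP => n /=; rewrite addNr. Qed.

HB.instance Definition _ := GRing.isZmodule.Build (fps A)
  fps_addA fps_addC fps_add0 fps_addN.

End FpsZmodule.

Section FpsRing.
Context (A : comNzRingType).
Implicit Types f g h : fps A.

Definition fpsC (a : A) : fps A := FPS (fun n => if n == 0%N then a else 0).
Definition fpsX : fps A := FPS (fun n => (n == 1%N)%:R).
Definition fps_mul f g : fps A :=
  FPS (fun n => \sum_(i < n.+1) fps_coef f i * fps_coef g (n - i)).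

Definition fps_trunc N f : {poly A} := \poly_(i < N) fps_coef f i.

Lemma coef_fps_trunc N f n : (n < N)%N -> (fps_trunc N f)`_n = fps_coef f n.
Proof. by move=> nN; rewrite coef_poly nN. Qed.

Lemma fps_coef_mul N f g n : (n < N)%N ->
  fps_coef (fps_mul f g) n = (fps_trunc N f * fps_trunc N g)`_n.
Proof.
move=> nN; rewrite coefM /=; apply: eq_bigr => i _; rewrite !coef_fps_trunc //.
  by rewrite (leq_ltn_trans (leq_subr _ _)).
by rewrite (leq_ltn_trans _ nN) // -ltnS.
Qed.

Fact fps_mulC : commutative fps_mul.
Proof. by move=> f g; apply: fpsP => n; rewrite !(@fps_coef_mul n.+1) // mulrC. Qed.

Fact fps_mulA : associative fps_mul.
Proof.
move=> f g h; apply: fpsP => n; rewrite !(@fps_coef_mul n.+1) //.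
transitivity ((fps_trunc n.+1 f * (fps_trunc n.+1 g * fps_trunc n.+1 h))`_n).
  rewrite [LHS]coefM [RHS]coefM; apply: eq_bigr => i _; congr (_ * _).
  have lt_n : (n - i < n.+1)%N by rewrite ltnS leq_subr.
  by rewrite coef_fps_trunc // (fps_coef_mul _ _ lt_n).
rewrite mulrA [LHS]coefM [RHS]coefM; apply: eq_bigr => i _; congr (_ * _).
by rewrite coef_fps_trunc // (@fps_coef_mul n.+1).
Qed.

Fact fps_mul1 : left_id (fpsC 1) fps_mul.
Proof.
move=> f; apply: fpsP => n /=.
by rewrite big_ord_recl /= mul1r subn0 big1 ?addr0 // => i _; rewrite mul0r.
Qed.

Fact fps_mulD : left_distributive fps_mul +%R.
Proof.
move=> f g h; apply: fpsP => n /=.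
by rewrite -big_split; apply: eq_bigr => i _; rewrite mulrDl.
Qed.

Fact fps_1_neq0 : fpsC 1 != 0.
Proof.
by apply/eqP => /(congr1 (fun f => fps_coef f 0)) /= /eqP; rewrite oner_eq0.
Qed.

HB.instance Definition _ := GRing.Zmodule_isComNzRing.Build (fps A)
  fps_mulA fps_mulC fps_mul1 fps_mulD fps_1_neq0.

Definition fps_unit : pred (fps A) := fun f => `[< exists g, g * f = 1 >].
Definition fps_inv f : fps A :=
  if pselect (exists g, g * f = 1) is left e then projT1 (cid e) else f.

Fact fps_mulVr : {in fps_unit, left_inverse 1 fps_inv *%R}.
Proof.
move=> f /asboolP uf; rewrite /fps_inv.
by case: pselect => // e; case: (cid e).
Qed.

Fact fps_unitP f g : g * f = 1 -> fps_unit f.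
Proof. by move=> gf1; apply/asboolP; exists g. Qed.

Fact fps_inv_out : {in [predC fps_unit], fps_inv =1 id}.
Proof.
move=> f /negP uf; rewrite /fps_inv; case: pselect => // e.
by case: uf; apply/asboolP.
Qed.

HB.instance Definition _ := GRing.ComNzRing_hasMulInverse.Build (fps A)
  fps_mulVr fps_unitP fps_inv_out.

Definition fps_deriv f : fps A := FPS (fun n => fps_coef f n.+1 *+ n.+1).

End FpsRing.

Section FpsIdomain.
Context (A : idomainType).

Lemma fps_order (f : fps A) : f != 0 ->
  exists2 n, fps_coef f n != 0 & forall k, (k < n)%N -> fps_coef f k = 0.
Proof.
move=> f0; have exf : exists n, fps_coef f n != 0.
  apply: contrapT => nex; move/eqP: f0; apply; apply: fpsP => n /=.
  by apply/eqP; apply: contrapT => /negP fn; apply: nex; exists n.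
case: (ex_minnP exf) => n fn min_n; exists n => // k kn; apply/eqP.
by apply: contraLR kn => /min_n; rewrite -leqNgt.
Qed.

Fact fps_integral : GRing.integral_domain_axiom (fps A).
Proof.
move=> f g fg0; apply: contraT; rewrite negb_or.
case/andP=> /fps_order[m fm minf] /fps_order[n gn ming].
have mP : (m < (m + n).+1)%N by rewrite ltnS leq_addr.
have /= := congr1 (fun h => fps_coef h (m + n)) fg0.
rewrite (bigD1 (Ordinal mP)) //= addKn big1 ?addr0 => [/eqP|i].
  by rewrite mulf_eq0 (negPf fm) (negPf gn).
rewrite -val_eqE /= neq_ltn => /orP[/minf->|mi]; first by rewrite mul0r.
rewrite [X in _ * X]ming ?mulr0 //.
by rewrite ltn_subLR ?ltn_add2r // -ltnS.
Qed.

HB.instance Definition _ :=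
  GRing.ComUnitRing_isIntegral.Build (fps A) fps_integral.

End FpsIdomain.

(** * Series in x and y

   fps (fps R) is R[[y]][[x]]: the coefficient of x^i y^j in f is
   fps_coef (fps_coef f i) j. *)

Definition deriv_x (A : comNzRingType) (f : fps (fps A)) : fps (fps A) :=
  fps_deriv f.
Definition deriv_y (A : comNzRingType) (f : fps (fps A)) : fps (fps A) :=
  FPS (fun i => fps_deriv (fps_coef f i)).

(* D-algebraicity of f over a set K of elements of the fraction field. *)
Definition diff_algebraic (S : idomainType) (K : {fraction S} -> Prop)
    (D : S -> S) (f : S) : Prop :=
  exists (m : nat) (P : mpoly m.+1 {fraction S}),
    [/\ P != 0, (forall mon, K (mcoeff mon P))
      & meval (fun i : 'I_m.+1 => tofrac (iter i D f)) P = 0].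

Section RationalFunctions.
Context (R : realType) (t : R).
Local Notation F := {fraction (fps (fps R))}.

Definition frac_x : F := tofrac (fpsX (fps R)).
Definition frac_y : F := tofrac (fpsC (fpsX R)).
Definition frac_cst (a : R) : F := tofrac (fpsC (fpsC a)).

Definition eval_xyt (p : mpoly 3 rat) : F :=
  mmap (fun a : rat => frac_cst (ratr a))
       (tnth [tuple frac_x; frac_y; frac_cst t]) p.

(* The subfield Q(x, y, t) of Frac R[[x, y]], t being a real number. *)
Definition in_Qxyt (f : F) : Prop :=
  exists p q : mpoly 3 rat, eval_xyt q != 0 /\ f = eval_xyt p / eval_xyt q.

Definition x_diff_algebraic (f : fps (fps R)) : Prop :=
  diff_algebraic in_Qxyt (@deriv_x R) f.
Definition y_diff_algebraic (f : fps (fps R)) : Prop :=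
  diff_algebraic in_Qxyt (@deriv_y R) f.

Definition x_diff_transcendental f : Prop := ~ x_diff_algebraic f.
Definition y_diff_transcendental f : Prop := ~ y_diff_algebraic f.

End RationalFunctions.

(** * Weighted walks in the quarter plane *)

(* (a, b) : step stands for the vector (a - 1, b - 1) of {-1, 0, 1}^2. *)
Definition step : finType := ('I_3 * 'I_3)%type.
Definition step_vec (s : step) : int * int := (s.1%:Z - 1, s.2%:Z - 1).

Definition weights (d : step -> rat) : Prop :=
  (forall s, 0 <= d s <= 1) /\ \sum_s d s = 1.

(* The endpoint of the path starting at (0, 0) with successive steps w. *)
Definition endpoint (w : seq step) : int * int := \sum_(s <- w) step_vec s.

(* A walk w_0, ..., w_k is given by its steps: w_r = endpoint (take r w). *)
Definition quarter_plane_walk (k : nat) (w : k.-tuple step) : bool :=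
  [forall r : 'I_k.+1,
     (0 <= (endpoint (take r w)).1) && (0 <= (endpoint (take r w)).2)].

Definition walk_weight (d : step -> rat) (w : seq step) : rat :=
  \prod_(s <- w) d s.

Definition walk_coef (d : step -> rat) (i j k : nat) : rat :=
  \sum_(w : k.-tuple step |
          quarter_plane_walk w && (endpoint w == (i%:Z, j%:Z)))
     walk_weight d w.

(* Q(x, y, t) for the fixed real number t, as a power series in x and y: the
   coefficient of x^i y^j is the sum of the convergent real series
   sum_k q_{i,j,k} t^k. *)
Definition walk_series (R : realType) (d : step -> rat) (t : R) :
    fps (fps R) :=
  FPS (fun i => FPS (fun j =>
    limn (series (fun k => ratr (walk_coef d i j k) * t ^+ k)))).

Definition model (d : step -> rat) : seq (int * int) :=
  [seq step_vec s | s <- enum {: step} & (step_vec s != (0, 0)) && (d s != 0)].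

Definition models_S : seq (seq (int * int)) :=
  [:: [:: (-1, 1); (0, 1); (1, -1)];
      [:: (-1, 1); (1, 1); (1, -1)];
      [:: (-1, 1); (0, 1); (1, 1); (1, -1)];
      [:: (-1, 1); (0, 1); (1, 1); (1, 0); (1, -1)];
      [:: (-1, 1); (0, 1); (1, 0); (1, -1)] ].

Definition arises_from_S (d : step -> rat) : Prop :=
  exists2 S, S \in models_S & model d =i S.

(* Main.v *)
Require Import Defs.
From HB Require Import structures.
From mathcomp Require Import all_boot all_order all_algebra.
From mathcomp Require Import boolp reals complex.
From mathcomp Require Import mpoly ring zify.
From mathcomp Require Import -(notations) topology normedtype sequences.

Set Implicit Arguments.
Unset Strict Implicit.
Unset Printing Implicit Defensive.

Import Order.TTheory GRing.Theory Num.Theory.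
Import numFieldNormedType.Exports.
Local Open Scope ring_scope.

(** Write a = d_(-1,1), b = d_(1,-1). No step of the model points into the half
plane i + j < 0, so the kernel K(x, y) = x y (1 - t sum_(i,j) d_(i,j) x^i y^j)
is a polynomial without constant or linear term and the walk series satisfies

   K(x, y) Q(x, y) = x y - A(x) - B(y),
   A(x) = t b x^2 Q(x, 0),  B(y) = t a y^2 Q(0, y)

(walk_functional_equation). In the coordinates 1/x, 1/y the curve K = 0 is a
conic. The slopes of its asymptotes are the two roots of
t (a be^2 + d_(0,0) be + b) = be; fix one root be and put rho = b / (a be^2), the
ratio of the two slopes. Placing the points at infinity of the conic at s = 0 and
s = oo parametrizes it by rational functions x(s), y(s) vanishing at s = 0, such
that (x(s), y(s)) and (x(s), y(rho s)) both lie on the curve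
(kernel_uniformization). Subtracting the functional equation at these two points
eliminates A, so that f(s) = B(y(s)) solves the difference equation

   f(rho s) - f(s) = g(s),  g(s) = x(s) (y(rho s) - y(s)).

If Q were x-differentially algebraic, substituting x = x(s) and letting y be a
constant, the chain rule would make f and its derivatives under s d/ds
algebraically dependent over k(s), where k contains y as well as the numbers at
hand; indeed A(x(s)) + f(s) = x(s) y(s) on the curve, and the equation at
(x(s), y) makes Q(x(s), y) an affine function of f over k(s)
(transfer_diff_transcendental, composite_independent). The same holds for y, with
the substitution y = y(s) and x constant, because B(y(s)) = f(s): one series f
serves both variables.

Since s d/ds commutes with s |-> rho s, an algebraic relation between the
derivatives of f implies a linear one between those of g modulo differences:
sum_i c_i (s d/ds)^i g = h(rho s) - h(s) with h in k(s) and constants c_i not all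
zero (difference_ostrowski, rat_dil_invariant). This is impossible as soon as g
has a pole z whose order exceeds the order of g at every other point rho^i z of
its orbit: each derivation raises the order by exactly one, whereas the poles of
h(rho s) - h(s) cannot be so isolated (no_lone_pole,
lone_pole_euler_independent).

Such a z exists because t is transcendental over the rationals. Then so is be,
and a point given by a polynomial in be with algebraic coefficients has a
well defined order in be; as rho has order -2, points whose orders have different
parities lie in different orbits. The poles of x are P1, P2 and those of y are
Q1, Q2 (ptP, ptQ). If d_(1,1) <> 0, the P_i have order 1 and the Q_i order 0, and
z = P1 is a simple pole of g, alone in its orbit up to P2, which lies in this
orbit only when P2 = P1. If d_(1,1) = 0, then P2 = Q2 and Q1 = rho P1, and z = P2
is a double pole of g, or a triple one if moreover d_(1,0) = 0. *)

(** * Truncation and derivation of power series *)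

Section FpsTruncation.
Context (A : comNzRingType).
Implicit Types (f g h u : fps A) (p q : {poly A}).

Lemma fps_coefD f g n : fps_coef (f + g) n = fps_coef f n + fps_coef g n.
Proof. by []. Qed.
Lemma fps_coefN f n : fps_coef (- f) n = - fps_coef f n.
Proof. by []. Qed.
Lemma fps_coef0 n : fps_coef (0 : fps A) n = 0.
Proof. by []. Qed.
Lemma fps_coefM f g n :
  fps_coef (f * g) n = \sum_(i < n.+1) fps_coef f i * fps_coef g (n - i).
Proof. by []. Qed.

Lemma fps_coef_sum I (r : seq I) (P : pred I) (G : I -> fps A) n :
  fps_coef (\sum_(i <- r | P i) G i) n = \sum_(i <- r | P i) fps_coef (G i) n.
Proof. by elim/big_rec2: _ => // i x y _ <-. Qed.

Definition poly_fps p : fps A := FPS (fun n => p`_n).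

Lemma coef_poly_fps p n : fps_coef (poly_fps p) n = p`_n.
Proof. by []. Qed.

Fact poly_fps_zmod : zmod_morphism poly_fps.
Proof. by move=> p q; apply: fpsP => n; rewrite /= coefB. Qed.
Fact poly_fps_monoid : monoid_morphism poly_fps.
Proof.
split=> [|p q]; apply: fpsP => n /=; first by rewrite coef1; case: n.
by rewrite coefM.
Qed.
HB.instance Definition _ :=
  GRing.isZmodMorphism.Build {poly A} (fps A) poly_fps poly_fps_zmod.
HB.instance Definition _ :=
  GRing.isMonoidMorphism.Build {poly A} (fps A) poly_fps poly_fps_monoid.

Lemma poly_fps_inj : injective poly_fps.
Proof.
by move=> p q pq; apply/polyP => n; have := congr1 (fun f => fps_coef f n) pq.
Qed.

Lemma poly_fpsC c : poly_fps c%:P = fpsC c.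
Proof. by apply: fpsP => n /=; rewrite coefC; case: n. Qed.

Lemma poly_fpsX : poly_fps 'X = fpsX A.
Proof. by apply: fpsP => n /=; rewrite coefX. Qed.

Fact fpsC_zmod : zmod_morphism (@fpsC A).
Proof. by move=> a b; rewrite -!poly_fpsC polyCB rmorphB. Qed.
Fact fpsC_monoid : monoid_morphism (@fpsC A).
Proof. by split=> [|a b] //; rewrite -!poly_fpsC polyCM rmorphM. Qed.
HB.instance Definition _ :=
  GRing.isZmodMorphism.Build A (fps A) (@fpsC A) fpsC_zmod.
HB.instance Definition _ :=
  GRing.isMonoidMorphism.Build A (fps A) (@fpsC A) fpsC_monoid.

Lemma fpsC_inj : injective (@fpsC A).
Proof. by move=> a b ab; have := congr1 (fun f => fps_coef f 0) ab. Qed.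

Lemma fpsC_eq0 (a : A) : (fpsC a == 0) = (a == 0).
Proof. by rewrite -(inj_eq fpsC_inj) rmorph0. Qed.

Lemma poly_fps_eq0 p : (poly_fps p == 0) = (p == 0).
Proof. by rewrite -(inj_eq poly_fps_inj) rmorph0. Qed.

Lemma fps_coefCM c f n : fps_coef (fpsC c * f) n = c * fps_coef f n.
Proof.
rewrite fps_coefM big_ord_recl /= subn0 big1 ?addr0 // => i _.
by rewrite mul0r.
Qed.

Lemma fps_coefXM f n :
  fps_coef (fpsX A * f) n = if n is m.+1 then fps_coef f m else 0.
Proof.
rewrite fps_coefM; case: n => [|n]; first by rewrite big_ord1 mul0r.
rewrite big_ord_recl big_ord_recl /= mul0r add0r mul1r subn1 big1 ?addr0 //.
by move=> i _; rewrite /= /bump /= mul0r.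
Qed.

(** Congruence modulo the N-th power of the variable: identities between series
are obtained from their truncations, which are polynomials. *)
Definition fps_eqm N f g := forall n, (n < N)%N -> fps_coef f n = fps_coef g n.

Lemma fps_eqmM N f f' g g' :
  fps_eqm N f f' -> fps_eqm N g g' -> fps_eqm N (f * g) (f' * g').
Proof.
move=> ff' gg' n nN; rewrite !fps_coefM; apply: eq_bigr => i _.
rewrite ff' ?gg' //; last by rewrite (leq_ltn_trans _ nN) // -ltnS.
by rewrite (leq_ltn_trans (leq_subr _ _)).
Qed.

Lemma fps_eqm_trunc N f : fps_eqm N f (poly_fps (fps_trunc N f)).
Proof. by move=> n nN; rewrite /= coef_fps_trunc. Qed.

Lemma fps_eqmP f g : (forall N, fps_eqm N f g) -> f = g.
Proof. by move=> fg; apply: fpsP => n; apply: (fg n.+1). Qed.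

(** A series without constant term may be substituted: its powers tend to 0. *)
Lemma fps_eqm_exp N u : fps_coef u 0 = 0 -> forall i, (N <= i)%N ->
  fps_eqm N (u ^+ i) 0.
Proof.
move=> u0; elim: N => // N IHN [//|i] Ni n nN.
rewrite exprS fps_coefM big1 // => -[[|j] jn] _ /=; first by rewrite u0 mul0r.
rewrite IHN ?mulr0 //; move: nN jn; rewrite !ltnS => nN jn.
by case: n nN jn => // n nN _; rewrite subSS (leq_ltn_trans (leq_subr _ _)).
Qed.

Lemma fps_derivC (a : A) : fps_deriv (fpsC a) = 0.
Proof. by apply: fpsP => n /=; rewrite mul0rn. Qed.

Lemma fps_derivD f g : fps_deriv (f + g) = fps_deriv f + fps_deriv g.
Proof. by apply: fpsP => n /=; rewrite mulrnDl. Qed.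

Lemma fps_deriv_eqm N f g :
  fps_eqm N.+1 f g -> fps_eqm N (fps_deriv f) (fps_deriv g).
Proof. by move=> fg n nN /=; rewrite fg. Qed.

Lemma fps_deriv_poly p : fps_deriv (poly_fps p) = poly_fps p^`().
Proof. by apply: fpsP => n /=; rewrite coef_deriv. Qed.

Lemma fps_eqm_trans N f g h : fps_eqm N f g -> fps_eqm N g h -> fps_eqm N f h.
Proof. by move=> fg gh n nN; rewrite fg // gh. Qed.
Lemma fps_eqm_sym N f g : fps_eqm N f g -> fps_eqm N g f.
Proof. by move=> fg n nN; rewrite fg. Qed.
Lemma fps_eqmW M N f g : (M <= N)%N -> fps_eqm N f g -> fps_eqm M f g.
Proof. by move=> MN fg n nM; rewrite fg // (leq_trans nM). Qed.
Lemma fps_eqmD N f f' g g' :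
  fps_eqm N f f' -> fps_eqm N g g' -> fps_eqm N (f + g) (f' + g').
Proof. by move=> ff' gg' n nN /=; rewrite ff' ?gg'. Qed.

Lemma fps_derivM f g : fps_deriv (f * g) = fps_deriv f * g + f * fps_deriv g.
Proof.
apply: fps_eqmP => N; set p := fps_trunc N.+1 f; set q := fps_trunc N.+1 g.
have pf : fps_eqm N.+1 f (poly_fps p) by apply: fps_eqm_trunc.
have qg : fps_eqm N.+1 g (poly_fps q) by apply: fps_eqm_trunc.
apply: fps_eqm_trans (fps_deriv_eqm (fps_eqmM pf qg)) _.
rewrite -rmorphM fps_deriv_poly derivM rmorphD !rmorphM /= -!fps_deriv_poly.
apply/fps_eqm_sym/fps_eqmD; apply: fps_eqmM; try exact: fps_deriv_eqm.
  exact: fps_eqmW qg.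
exact: fps_eqmW pf.
Qed.

End FpsTruncation.

(** * Substitution in power series *)

Section Composition.
Context (A B : comNzRingType) (phi : {rmorphism A -> fps B}) (u : fps B).
Hypothesis u0 : fps_coef u 0 = 0.
Implicit Types (f g : fps A) (p q : {poly A}).

Let ev p : fps B := (map_poly phi p).[u].

Let evB p q : ev (p - q) = ev p - ev q.
Proof. by rewrite /ev rmorphB hornerD hornerN. Qed.

Let evM p q : ev (p * q) = ev p * ev q.
Proof. by rewrite /ev rmorphM hornerM. Qed.

Let ev_low N p : (forall i, (i < N)%N -> p`_i = 0) -> fps_eqm N (ev p) 0.
Proof.
move=> p0 n nN; rewrite /ev horner_coef fps_coef_sum big1 // => i _.
rewrite coef_map; have [iN|Ni] := ltnP i N.
  by rewrite p0 // [X in X * _](rmorph0 phi) mul0r.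
have := fps_eqmM (fun k _ => erefl (fps_coef (phi p`_i) k))
  (fps_eqm_exp (N := N) u0 Ni) nN.
by rewrite mulr0.
Qed.

Let ev_eqm N p q : (forall i, (i < N)%N -> p`_i = q`_i) ->
  fps_eqm N (ev p) (ev q).
Proof.
move=> pq n nN; apply/eqP; rewrite -subr_eq0; apply/eqP.
rewrite -fps_coefN -fps_coefD -evB; apply: (ev_low _ nN) => i iN.
by rewrite coefB pq ?subrr.
Qed.

(** The image of the series f under the continuous extension of phi that sends
the variable to u. *)
Definition fps_comp_of of fps_coef u 0 = 0 := fun f =>
  FPS (fun n => fps_coef (ev (fps_trunc n.+1 f)) n).
Local Notation comp := (fps_comp_of u0).

Let comp_eqm N f : fps_eqm N (comp f) (ev (fps_trunc N f)).
Proof.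
move=> n nN /=; apply: (@ev_eqm n.+1) => // i.
by rewrite ltnS => i_n; rewrite !coef_fps_trunc // (leq_ltn_trans i_n nN).
Qed.

Lemma fps_comp_eqm N f : fps_eqm N (comp f) (map_poly phi (fps_trunc N f)).[u].
Proof. exact: comp_eqm. Qed.

Fact fps_comp_zmod : zmod_morphism comp.
Proof.
move=> f g; apply: fps_eqmP => N n nN; rewrite (comp_eqm _ nN).
have -> : fps_trunc N (f - g) = fps_trunc N f - fps_trunc N g.
  by apply/polyP => i; rewrite coefB !coef_poly; case: ifP; rewrite ?subr0.
by rewrite evB fps_coefD fps_coefN -!(comp_eqm _ nN).
Qed.

Fact fps_comp_monoid : monoid_morphism comp.
Proof.
split=> [|f g]; apply: fps_eqmP => N.
  apply: fps_eqm_trans (comp_eqm _) _.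
  apply: (@fps_eqm_trans _ _ _ (ev 1)); last first.
    by rewrite /ev rmorph1 hornerC.
  by apply: ev_eqm => i iN; rewrite coef_fps_trunc // coef1; case: i iN.
apply: fps_eqm_trans (comp_eqm _) _.
apply: (@fps_eqm_trans _ _ _ (ev (fps_trunc N f * fps_trunc N g))).
  apply: ev_eqm => i iN; rewrite coef_fps_trunc //.
  by rewrite -(fps_coef_mul _ _ iN).
by rewrite evM; apply/fps_eqm_sym/fps_eqmM; apply: comp_eqm.
Qed.

HB.instance Definition _ :=
  GRing.isZmodMorphism.Build (fps A) (fps B) comp fps_comp_zmod.
HB.instance Definition _ :=
  GRing.isMonoidMorphism.Build (fps A) (fps B) comp fps_comp_monoid.

Lemma fps_comp_poly p : comp (poly_fps p) = ev p.
Proof.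
apply: fps_eqmP => N; apply: fps_eqm_trans (comp_eqm _) _.
by apply: ev_eqm => i iN; rewrite coef_fps_trunc.
Qed.

Lemma fps_compC a : comp (fpsC a) = phi a.
Proof. by rewrite -poly_fpsC fps_comp_poly /ev map_polyC hornerC. Qed.

Lemma fps_compX : comp (fpsX A) = u.
Proof. by rewrite -poly_fpsX fps_comp_poly /ev map_polyX hornerX. Qed.

Lemma fps_deriv_comp f : (forall a, fps_deriv (phi a) = 0) ->
  fps_deriv (comp f) = comp (fps_deriv f) * fps_deriv u.
Proof.
move=> phi0.
have ev' p : fps_deriv (ev p) = ev p^`() * fps_deriv u.
  elim/poly_ind: p => [|p c IHp].
    rewrite deriv0 /ev rmorph0 horner0 mul0r.
    by apply: fpsP => n /=; rewrite mul0rn.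
  rewrite derivD derivM derivX derivC addr0 mulr1.
  rewrite /ev !rmorphD !rmorphM /= !map_polyX map_polyC !hornerE.
  rewrite fps_derivD phi0 addr0 fps_derivM -/(ev p) IHp.
  by rewrite /ev mulrDl mulrAC.
apply: fps_eqmP => N; apply: fps_eqm_trans (fps_deriv_eqm (comp_eqm _)) _.
rewrite ev'; apply: fps_eqmM => //; apply/fps_eqm_sym.
apply: fps_eqm_trans (comp_eqm _) _; apply: ev_eqm => i iN.
by rewrite coef_fps_trunc // coef_deriv coef_fps_trunc.
Qed.

End Composition.

(** * Transposition of the two variables *)

Section Transposition.
Context (A : comNzRingType).
Implicit Types f g : fps (fps A).

Definition fps_tr f : fps (fps A) :=
  FPS (fun j => FPS (fun i => fps_coef (fps_coef f i) j)).

Fact fps_tr_zmod : zmod_morphism fps_tr.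
Proof. by move=> f g; apply: fpsP => j; apply: fpsP. Qed.

Lemma fps_coef2M f g i j : fps_coef (fps_coef (f * g) i) j =
  \sum_(k < i.+1) \sum_(l < j.+1) fps_coef (fps_coef f k) l *
     fps_coef (fps_coef g (i - k)) (j - l).
Proof. by rewrite fps_coefM fps_coef_sum; apply: eq_bigr. Qed.

Fact fps_tr_monoid : monoid_morphism fps_tr.
Proof.
split=> [|f g]; apply: fpsP => j; apply: fpsP => i.
  by case: i; case: j.
by rewrite fps_coef2M exchange_big [LHS]fps_coef2M.
Qed.
HB.instance Definition _ :=
  GRing.isZmodMorphism.Build (fps (fps A)) (fps (fps A)) fps_tr fps_tr_zmod.
HB.instance Definition _ :=
  GRing.isMonoidMorphism.Build (fps (fps A)) (fps (fps A)) fps_tr fps_tr_monoid.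

Lemma fps_trK : involutive fps_tr.
Proof. by move=> f; apply: fpsP => i; apply: fpsP. Qed.

Lemma fps_tr_deriv f : fps_tr (deriv_y f) = fps_deriv (fps_tr f).
Proof.
have coefMn (g : fps A) n j : fps_coef (g *+ n) j = fps_coef g j *+ n.
  by elim: n => [|n IHn]; rewrite ?mulr0n // !mulrSr fps_coefD IHn.
by apply: fpsP => i; apply: fpsP => j; rewrite /= coefMn.
Qed.

End Transposition.

(** * Dilation of the variable *)

Section Dilation.
Context (A : comNzRingType).
Implicit Types (rho : A) (f g : fps A).

Definition fps_dil rho f : fps A := FPS (fun n => fps_coef f n * rho ^+ n).

Lemma coef_dil rho f n : fps_coef (fps_dil rho f) n = fps_coef f n * rho ^+ n.
Proof. by []. Qed.

Fact fps_dil_zmod rho : zmod_morphism (fps_dil rho).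
Proof. by move=> f g; apply: fpsP => n /=; rewrite mulrBl. Qed.

Fact fps_dil_monoid rho : monoid_morphism (fps_dil rho).
Proof.
split=> [|f g]; apply: fpsP => n /=.
  by case: n => [|n] /=; rewrite ?mulr1 ?mul0r.
rewrite mulr_suml; apply: eq_bigr => -[i /= i_n] _.
by rewrite mulrACA -exprD subnKC.
Qed.
HB.instance Definition _ rho :=
  GRing.isZmodMorphism.Build (fps A) (fps A) (fps_dil rho) (fps_dil_zmod rho).
HB.instance Definition _ rho := GRing.isMonoidMorphism.Build (fps A) (fps A)
  (fps_dil rho) (fps_dil_monoid rho).

Definition poly_dil rho (p : {poly A}) : {poly A} := p \Po (rho *: 'X).

Fact poly_dil_zmod rho : zmod_morphism (poly_dil rho).
Proof. by move=> p q; rewrite /poly_dil rmorphB. Qed.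
Fact poly_dil_monoid rho : monoid_morphism (poly_dil rho).
Proof. by split=> [|p q]; rewrite /poly_dil ?rmorph1 ?rmorphM. Qed.
HB.instance Definition _ rho := GRing.isZmodMorphism.Build {poly A} {poly A}
  (poly_dil rho) (poly_dil_zmod rho).
HB.instance Definition _ rho := GRing.isMonoidMorphism.Build {poly A} {poly A}
  (poly_dil rho) (poly_dil_monoid rho).

Lemma poly_dilX rho : poly_dil rho 'X = rho *: 'X.
Proof. by rewrite /poly_dil comp_polyX. Qed.
Lemma poly_dilC rho c : poly_dil rho c%:P = c%:P.
Proof. by rewrite /poly_dil comp_polyC. Qed.

Lemma horner_dil rho p z : (poly_dil rho p).[z] = p.[rho * z].
Proof. by rewrite /poly_dil horner_comp hornerZ hornerX. Qed.

Lemma fps_dil_poly rho p : fps_dil rho (poly_fps p) = poly_fps (poly_dil rho p).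
Proof.
elim/poly_ind: p => [|p c IHp]; first by rewrite !rmorph0.
rewrite !rmorphD !rmorphM /= IHp poly_dilX poly_dilC; congr (_ * _ + _).
  by apply: fpsP => -[|[|n]] /=; rewrite coefZ coefX /= ?mul0r ?mulr0 // mul1r mulr1.
by apply: fpsP => -[|n] /=; rewrite coefC /= ?mulr1 ?mul0r.
Qed.

(** The derivation s d/ds, which commutes with dilations. *)
Definition euler f : fps A := fpsX A * fps_deriv f.

Lemma coef_euler f n : fps_coef (euler f) n = fps_coef f n *+ n.
Proof. by rewrite fps_coefXM; case: n => [|n]; rewrite ?mulr0n. Qed.

Lemma eulerD f g : euler (f + g) = euler f + euler g.
Proof. by rewrite /euler fps_derivD mulrDr. Qed.
Lemma eulerM f g : euler (f * g) = euler f * g + f * euler g.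
Proof. by rewrite /euler fps_derivM mulrDr mulrA [X in _ + X]mulrCA. Qed.
Lemma euler_dil rho f : euler (fps_dil rho f) = fps_dil rho (euler f).
Proof. by apply: fpsP => n; rewrite coef_euler !coef_dil coef_euler mulrnAl. Qed.
Lemma euler_poly p : euler (poly_fps p) = poly_fps ('X * p^`()).
Proof. by rewrite /euler fps_deriv_poly rmorphM /= poly_fpsX. Qed.

End Dilation.

(** * Field morphisms between fraction fields *)

Section FractionMorphism.
Context (S T : idomainType) (phi : {rmorphism S -> T}).
Hypothesis phi_inj : injective phi.

Fact frac_map_key : unit. Proof. exact: tt. Qed.
(** Computed on the chosen representative n / d of a fraction. It is locked since
only frac_map_tofrac and the morphism structure are meant to be used. *)
Definition frac_map of injective phi :=
  locked_with frac_map_key (fun x : {fraction S} =>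
    tofrac (phi (\n_(repr x))) / tofrac (phi (\d_(repr x)))).
Local Notation ext := (frac_map phi_inj).

Lemma tofrac_repr (x : {fraction S}) :
  x = tofrac (\n_(repr x)) / tofrac (\d_(repr x)).
Proof.
have d0 := denom_ratioP (repr x).
apply: (canRL (mulfK _)); first by rewrite tofrac_eq0.
rewrite -{1}[x]reprK; move: (repr x) d0 => r d0; unlock tofrac.
rewrite -[LHS]FracField.pi_mul; apply/eqmodP.
rewrite /= FracField.equivfE /FracField.mulf.
by rewrite !numden_Ratio ?mulr1 ?mulf_neq0 ?oner_neq0 // mulrC.
Qed.

Lemma fracP (x : {fraction S}) :
  exists n d : S, d != 0 /\ x = tofrac n / tofrac d.
Proof.
exists (\n_(repr x)), (\d_(repr x)).
split; [exact: denom_ratioP | exact: tofrac_repr].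
Qed.

Let phi_eq0 x : (phi x == 0) = (x == 0).
Proof. by rewrite -(inj_eq phi_inj) rmorph0. Qed.

Let mapE n d : d != 0 ->
  ext (tofrac n / tofrac d) = tofrac (phi n) / tofrac (phi d).
Proof.
move=> d0; rewrite /frac_map locked_withE; set x := tofrac n / tofrac d.
have /eqP := tofrac_repr x; have := denom_ratioP (repr x).
move: (\n_(repr x)) (\d_(repr x)) => n' d' d'0; rewrite {}/x.
rewrite !eqr_div ?tofrac_eq0 // -!rmorphM tofrac_eq => /eqP nd.
apply/eqP; rewrite eqr_div ?tofrac_eq0 ?phi_eq0 //.
by rewrite -!rmorphM nd.
Qed.

Lemma frac_map_tofrac x : ext (tofrac x) = tofrac (phi x).
Proof.
have := mapE x (oner_neq0 S).
by rewrite !rmorph1 !divr1.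
Qed.

Fact frac_map_zmod : zmod_morphism ext.
Proof.
move=> x y; have [n [d [d0 ->]]] := fracP x; have [n' [d' [d'0 ->]]] := fracP y.
rewrite -mulNr -rmorphN addf_div ?tofrac_eq0 // -!(rmorphM, rmorphD).
rewrite !mapE ?mulf_neq0 // -mulNr -rmorphN addf_div ?tofrac_eq0 ?phi_eq0 //.
by rewrite !(rmorphM, rmorphD, rmorphN).
Qed.

Fact frac_map_monoid : monoid_morphism ext.
Proof.
split=> [|x y]; first by rewrite -(rmorph1 (@tofrac S)) frac_map_tofrac !rmorph1.
have [n [d [d0 ->]]] := fracP x; have [n' [d' [d'0 ->]]] := fracP y.
rewrite mulf_div -!rmorphM !mapE ?mulf_neq0 // mulf_div.
by rewrite !rmorphM.
Qed.

HB.instance Definition _ := GRing.isZmodMorphism.Build {fraction S} {fraction T}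
  ext frac_map_zmod.
HB.instance Definition _ := GRing.isMonoidMorphism.Build {fraction S} {fraction T}
  ext frac_map_monoid.

End FractionMorphism.

(** * Comparison and injectivity of substitutions *)

Section CompositionTheory.
Context (A B : comNzRingType).

Lemma eq_fps_comp (A' : comNzRingType) (phi : {rmorphism A -> fps B})
    (psi : {rmorphism A' -> fps B}) (u : fps B) (u0 : fps_coef u 0 = 0) f g :
  (forall n, phi (fps_coef f n) = psi (fps_coef g n)) ->
  fps_comp_of phi u0 f = fps_comp_of psi u0 g.
Proof.
move=> fg; apply: fps_eqmP => N; apply: fps_eqm_trans (@fps_comp_eqm _ _ phi u u0 N f) _.
apply/fps_eqm_sym; apply: fps_eqm_trans (@fps_comp_eqm _ _ psi u u0 N g) _.
suff -> : map_poly psi (fps_trunc N g) = map_poly phi (fps_trunc N f) by [].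
apply/polyP => n; rewrite !coef_map !coef_poly; case: ifP => _; first exact: esym (fg n).
by rewrite !raddf0.
Qed.

(** Dilating s in f(u(s)) amounts to replacing u(s) by u(rho s): this evaluates the
dilation of B(y(s)) although B is an unknown series. *)
Lemma fps_dil_comp rho (phi : {rmorphism A -> fps B}) (u : fps B)
    (u0 : fps_coef u 0 = 0) (v0 : fps_coef (fps_dil rho u) 0 = 0) f :
  (forall a, fps_dil rho (phi a) = phi a) ->
  fps_dil rho (fps_comp_of phi u0 f) = fps_comp_of phi v0 f.
Proof.
move=> dil_phi; apply: fps_eqmP => N.
apply: (@fps_eqm_trans _ _ _ (fps_dil rho (map_poly phi (fps_trunc N f)).[u])).
  by move=> n nN; rewrite !coef_dil (@fps_comp_eqm _ _ phi u u0 N f n nN).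
apply/fps_eqm_sym; apply: fps_eqm_trans (@fps_comp_eqm _ _ phi _ v0 N f) _.
elim/poly_ind: (fps_trunc N f) => [|p c IHp].
  by rewrite rmorph0 !horner0 rmorph0.
have evE v : (map_poly phi (p * 'X + c%:P)).[v] = (map_poly phi p).[v] * v + phi c.
  by rewrite rmorphD rmorphM /= map_polyX map_polyC !hornerE.
rewrite !evE [fps_dil _ (_ + _)]rmorphD /= [fps_dil _ (_ * _)]rmorphM /= dil_phi.
by apply: fps_eqmD => //; apply: fps_eqmM.
Qed.

End CompositionTheory.

(** Factor out the lowest power X^n of a nonzero f, so that f = X^n g. The image
u^n g(u) vanishes only if g(u) does, but the constant term of g(u) is that of the
image of the lowest coefficient of f. *)
Lemma fps_comp_inj (A : comNzRingType) (B : idomainType)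
    (phi : {rmorphism A -> fps B}) (u : fps B) (u0 : fps_coef u 0 = 0) :
  (forall a, a != 0 -> fps_coef (phi a) 0 != 0) -> u != 0 ->
  injective (fps_comp_of phi u0).
Proof.
move=> phi_inj un0; apply: raddf_inj => f f0; apply/eqP; apply: contraT => fn0.
have exf : exists n, fps_coef f n != 0.
  apply: contrapT => nex; move/eqP: fn0; apply; apply: fpsP => n.
  by apply/eqP; apply: contrapT => /negP fn; apply: nex; exists n.
case: (ex_minnP exf) => n fn min_n.
pose g := FPS (fun i => fps_coef f (n + i)).
have Xn m (h : fps A) i : fps_coef (fpsX A ^+ m * h) i =
    if (i < m)%N then 0 else fps_coef h (i - m).
  elim: m i => [|m IHm] i; first by rewrite mul1r subn0.
  by rewrite exprS -mulrA fps_coefXM; case: i => // i; rewrite IHm.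
have fE : f = fpsX A ^+ n * g.
  apply: fpsP => i; rewrite Xn; case: ltnP => [i_n|n_i]; last by rewrite /= subnKC.
  by apply/eqP; apply: contraLR i_n => /min_n; rewrite -leqNgt.
clearbody g; have {f0} : fps_comp_of phi u0 f = 0 by exact: f0.
rewrite {1}fE => /eqP; rewrite rmorphM rmorphXn /= fps_compX mulf_eq0 expf_eq0.
rewrite (negPf un0) andbF /= => /eqP g0; have := phi_inj _ fn.
have gn : fps_coef g 0 = fps_coef f n by rewrite fE Xn ltnn subnn.
have -> : phi (fps_coef f n) = (map_poly phi (fps_trunc 1 g)).[u].
  have -> : fps_trunc 1 g = (fps_coef f n)%:P.
    apply/polyP => i; rewrite coef_poly coefC; case: i => //=.
  by rewrite map_polyC hornerC.
by rewrite -(@fps_comp_eqm _ _ phi u u0 1 g 0 (ltn0Sn 0)) g0 eqxx.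
Qed.

Arguments frac_map : simpl never.
Arguments fps_comp_of : simpl never.
Arguments fps_dil : simpl never.
Arguments poly_dil : simpl never.
Arguments poly_fps : simpl never.

(** * Algebraic dependence and affine changes of variables *)

Section Substitution.
Context (K : comNzRingType) (F : comNzRingType) (iota : {rmorphism K -> F}).
Context (n : nat).

Lemma mmap_comp_mpoly (k : nat) (f : 'I_k -> F) (L : n.-tuple {mpoly K[k]})
    (P : {mpoly K[n]}) :
  mmap iota f (P \mPo L) = mmap iota (fun i => mmap iota f (tnth L i)) P.
Proof.
rewrite comp_mpolyEX raddf_sum /= [in RHS]/mmap; apply: eq_bigr => m _.
rewrite mmapZ comp_mpolyX rmorph_prod; congr (_ * _).
by apply: eq_bigr => i _; rewrite rmorphXn.
Qed.

Lemma mmap_map_mpoly (sK : {rmorphism K -> K}) (sF : {rmorphism F -> F})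
    (f : 'I_n -> F) (P : {mpoly K[n]}) :
  (forall c, iota (sK c) = sF (iota c)) ->
  mmap iota (fun i => sF (f i)) (map_mpoly sK P) = sF (mmap iota f P).
Proof.
move=> iotaE; elim/mpolyind: P => [|c m P _ _ IHP].
  by rewrite !rmorph0.
rewrite !rmorphD /= IHP; congr (_ + _).
rewrite map_mpolyZ map_mpolyX !mmapZ !mmapX rmorphM iotaE; congr (_ * _).
by rewrite rmorph_prod; apply: eq_bigr => i _; rewrite rmorphXn.
Qed.

End Substitution.

Section TopCoefficients.
Context (K : comNzRingType) (n : nat) (b : 'I_n -> K).
Implicit Types P : {mpoly K[n]}.

Let shift P := P \mPo [tuple 'X_i + (b i)%:MP | i < n].
Let lin P := \sum_i b i *: P^`M(i).
Let rest P := shift P - P - lin P.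

Let msize_lin m : (msize (lin 'X_[m]) <= mdeg m)%N.
Proof.
apply: (leq_trans (mmeasure_sum _ _ _ _)); apply/bigmax_leqP => i _.
apply: leq_trans (msizeZ_le _ _) _; rewrite mderivX.
case: (posnP (m i)) => [->|mi]; first by rewrite scale0r mmeasure0.
apply: leq_trans (msizeZ_le _ _) _; rewrite msizeX.
have le_im : (U_(i) <= m)%MM by rewrite lep1mP -lt0n.
by rewrite -{2}(submK le_im) mdegD mdeg1 addn1.
Qed.

Let msize_rest m : (msize (rest 'X_[m]) <= (mdeg m).-1)%N.
Proof.
elim: {m}(mdeg m) {-2}m (erefl (mdeg m)) => [|d IHd] m mE.
  move/eqP: (mE); rewrite mdeg_eq0 => /eqP ->.
  rewrite /rest /shift mpolyX0 comp_mpoly1 subrr sub0r mmeasureN /lin big1.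
    by rewrite mmeasure0.
  by move=> i _; rewrite mderivC scaler0.
have [j mj] : exists j, (0 < m j)%N.
  apply/existsP; apply: contra_eqT mE; rewrite negb_exists => /forallP m0.
  by rewrite mdegE big1 // => j _; apply/eqP; rewrite -leqn0 leqNgt.
have le_jm : (U_(j) <= m)%MM by rewrite lep1mP -lt0n.
move: mE; rewrite -(submK le_jm); move: (m - U_(j))%MM => {m mj le_jm} m.
rewrite mdegD mdeg1 addn1 /= => -[mE].
have shiftM : shift 'X_[m + U_(j)] = shift 'X_[m] * ('X_j + (b j)%:MP).
  by rewrite /shift mpolyXD rmorphM /= comp_mpolyXU -tnth_nth tnth_mktuple.
have dX i : ('X_j : {mpoly K[n]})^`M(i) = (i == j)%:R%:MP.
  rewrite mderivX mnm1E eq_sym; case: eqP => [->|_]; last first.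
    by rewrite scale0r mpolyC0.
  have -> : (U_(j) - U_(j) = 0 :> 'X_{1..n})%MM.
    by apply/mnmP => k; rewrite mnmBE subnn mnm0E.
  by rewrite mpolyX0 scale1r.
have linM : lin 'X_[m + U_(j)] = lin 'X_[m] * 'X_j + b j *: 'X_[m].
  rewrite /lin mpolyXD mulr_suml (bigD1 j) //= [in RHS](bigD1 j) //=.
  rewrite mderivM dX eqxx mpolyC1 mulr1 scalerDr -!addrA scalerAl.
  congr (_ + _); rewrite addrC; congr (_ + _); apply: eq_bigr => i ij.
  by rewrite mderivM dX (negPf ij) mpolyC0 mulr0 addr0 scalerAl.
have -> : rest 'X_[m + U_(j)] =
    rest 'X_[m] * 'X_j + b j *: (rest 'X_[m] + lin 'X_[m]).
  by rewrite /rest shiftM linM mpolyXD -!mul_mpolyC; ring.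
apply: leq_trans (mmeasureD_le _ _ _) _; rewrite geq_max; apply/andP; split.
  have := IHd m mE; set r := rest _ => r_le.
  rewrite msizeE; apply/bigmax_leqP_seq => k.
  rewrite (perm_mem (msuppMX _ _)) => /mapP[k' k'r ->] _.
  rewrite mdegD mdeg1 add1n -ltnS; have := leq_trans (msize_mdeg_lt k'r) r_le.
  by case: (mdeg m).
apply: leq_trans (msizeZ_le _ _) _.
apply: leq_trans (mmeasureD_le _ _ _) _; rewrite geq_max msize_lin andbT.
by apply: leq_trans (IHd m mE) _; rewrite leq_pred.
Qed.

(** Taylor expansion to the first order: in degree at least deg P - 1, the
polynomial P(X + b) only sees P and its first derivatives. *)
Lemma mcoeff_shift P m : (msize P <= (mdeg m).+2)%N ->
  (P \mPo [tuple 'X_i + (b i)%:MP | i < n])@_m =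
  P@_m + \sum_i b i * (P@_(m + U_(i)) *+ (m i).+1).
Proof.
move=> Pm.
have restD p q c : rest (c *: p + q) = c *: rest p + rest q.
  rewrite /rest; have -> : lin (c *: p + q) = c *: lin p + lin q.
    rewrite /lin scaler_sumr -big_split; apply: eq_bigr => i _.
    by rewrite linearP /= scalerDr !scalerA [b i * c]mulrC.
  by rewrite /shift linearP /= -!mul_mpolyC; ring.
have : (rest P)@_m = 0.
  have -> : rest P = \sum_(k <- msupp P) P@_k *: rest 'X_[k].
    rewrite {1}[P]mpolyE; elim: (msupp P) => [|k s IHs].
      rewrite !big_nil; have := restD 0 0 (-1).
      by rewrite scaler0 add0r scaleN1r addNr.
    by rewrite !big_cons restD IHs.
  rewrite raddf_sum big_seq big1 //= => k kP; rewrite mcoeffZ.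
  rewrite [X in _ * X]memN_msupp_eq0 ?mulr0 //; apply: msize_mdeg_ge.
  apply: leq_trans (msize_rest k) _; rewrite -subn1 leq_subLR add1n -ltnS.
  exact: leq_trans (msize_mdeg_lt kP) Pm.
rewrite /rest !mcoeffB => /eqP; rewrite !subr_eq0 => /eqP/(canRL (subrK _)) ->.
rewrite addrC; congr (_ + _); rewrite raddf_sum; apply: eq_bigr => i _.
by rewrite /= mcoeffZ mcoeff_mderiv.
Qed.

End TopCoefficients.

Definition alg_dependent (K F : fieldType) (iota : {rmorphism K -> F}) (n : nat)
    (f : 'I_n -> F) : Prop :=
  exists2 P : {mpoly K[n]}, P != 0 & mmap iota f P = 0.

Section AlgebraicDependence.
Context (K F : fieldType) (iota : {rmorphism K -> F}) (n : nat).
Implicit Types (f g : 'I_n -> F).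

Lemma eq_mmap f g P : f =1 g -> mmap iota f P = mmap iota g P.
Proof.
by move=> fg; apply: eq_bigr => m _; congr (_ * _); apply: mmap1_eq.
Qed.

(** An invertible affine substitution has an inverse, hence the polynomial
obtained by substituting it in a nonzero relation is nonzero. *)
Lemma alg_dependent_affine f g (T : 'M[K]_n) (e : 'I_n -> K) :
  T \in unitmx -> (forall i, g i = \sum_j iota (T i j) * f j + iota (e i)) ->
  alg_dependent iota g -> alg_dependent iota f.
Proof.
move=> Tu gE [P P0 Pg].
pose L := [tuple \sum_j T i j *: 'X_j + (e i)%:MP | i < n] : n.-tuple {mpoly K[n]}.
exists (P \mPo L); last first.
  rewrite mmap_comp_mpoly -[RHS]Pg; apply: eq_mmap => i.
  rewrite tnth_mktuple gE rmorphD /= mmapC raddf_sum; congr (_ + _).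
  by apply: eq_bigr => j _; rewrite /= mmapZ mmapX mmap1U.
pose M := [tuple \sum_i (invmx T) j i *: ('X_i - (e i)%:MP) | j < n]
  : n.-tuple {mpoly K[n]}.
apply: contraNneq P0 => PL0.
have <- : (P \mPo L) \mPo M = P.
  rewrite /comp_mpoly mmap_comp_mpoly -[RHS]comp_mpoly_id; apply: eq_bigr => m _.
  congr (_ * _); apply: mmap1_eq => i; rewrite !tnth_mktuple.
  rewrite rmorphD /= mmapC raddf_sum /=.
  have TM j : mmap (@mpolyC n K) (tnth M) (T i j *: 'X_j) =
      \sum_k (T i j * invmx T j k) *: ('X_k - (e k)%:MP).
    rewrite mmapZ mmapX mmap1U tnth_mktuple mul_mpolyC scaler_sumr.
    by apply: eq_bigr => k _; rewrite scalerA.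
  rewrite (eq_bigr _ (fun j _ => TM j)) exchange_big /=.
  under eq_bigr => k _ do rewrite -scaler_suml.
  have TT k : \sum_j T i j * invmx T j k = (i == k)%:R.
    by have /matrixP/(_ i k) := mulmxV Tu; rewrite !mxE.
  rewrite (bigD1 i) //= TT eqxx scale1r big1 ?addr0 ?subrK // => k ki.
  by rewrite TT eq_sym (negPf ki) scale0r.
by rewrite PL0 comp_mpoly0.
Qed.

(** Kolchin's difference analogue of Ostrowski's theorem. Among the relations
between the f_i take one whose leading monomial is minimal and whose leading
coefficient is 1. Its image under the endomorphism is the relation
P^s(X + b) = 0, with the same leading term, so that minimality forces
P^s(X + b) = P as polynomials. The coefficients of top degree are thus invariant
and comparing coefficients one degree below gives the linear relation. *)
Theorem difference_ostrowski (sK : {rmorphism K -> K}) (sF : {rmorphism F -> F})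
    f (b : 'I_n -> K) :
  (forall c, iota (sK c) = sF (iota c)) ->
  (forall i, sF (f i) = f i + iota (b i)) ->
  (forall k, k.+1%:R != 0 :> K) ->
  alg_dependent iota f ->
  exists c h, [/\ exists i, c i != 0, forall i, sK (c i) = c i
    & \sum_i c i * b i = sK h - h].
Proof.
move=> iotaE sFf char0 [P P0 Pf0]; elim/mleadrect: P P0 Pf0 => P IH P0 Pf0.
wlog P1 : P IH P0 Pf0 / mleadc P = 1.
  have c0 : mleadc P != 0 by rewrite mleadc_eq0.
  have c'0 := invr_neq0 c0.
  move=> /(_ ((mleadc P)^-1 *: P)); apply.
  - by move=> Q; rewrite mleadZ //; apply: IH.
  - by rewrite -mleadc_eq0 mleadcZE mulVf ?oner_neq0.
  - by rewrite mmapZ Pf0 mulr0.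
  - by rewrite mleadcZE mulVf.
set M := mlead P in P1; pose Ps := map_mpoly sK P.
have sizePs : (msize Ps <= (mdeg M).+1)%N.
  rewrite mlead_deg // msizeE; apply/bigmax_leqP_seq => m.
  rewrite mcoeff_msupp mcoeff_map_mpoly => Pm _; apply: msize_mdeg_lt.
  by rewrite mcoeff_msupp; apply: contraNneq Pm => ->; rewrite raddf0.
pose Q := Ps \mPo [tuple 'X_i + (b i)%:MP | i < n].
have Qf0 : mmap iota f Q = 0.
  rewrite mmap_comp_mpoly -[RHS](rmorph0 sF) -Pf0 -(mmap_map_mpoly _ _ iotaE).
  apply: eq_mmap => i.
  by rewrite tnth_mktuple rmorphD /= mmapC mmapX mmap1U sFf.
have coefQ m : (mdeg M <= (mdeg m).+1)%N ->
    Q@_m = sK P@_m + \sum_i b i * (sK P@_(m + U_(i)) *+ (m i).+1).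
  move=> Mm; rewrite mcoeff_shift ?mcoeff_map_mpoly.
    by under eq_bigr => i _ do rewrite mcoeff_map_mpoly.
  exact: leq_trans sizePs _.
have coefQtop m : (mdeg M <= mdeg m)%N -> Q@_m = sK P@_m.
  move=> Mm; rewrite coefQ 1?ltnW // big1 ?addr0 // => i _.
  rewrite memN_msupp_eq0 ?rmorph0 ?mul0rn ?mulr0 //.
  by apply: msize_mdeg_ge; rewrite -mlead_deg // mdegD mdeg1 addn1.
have [/eqP|R0] := eqVneq (Q - P) 0; last first.
  apply: (IH _ _ R0); last by rewrite rmorphB /= Qf0 Pf0 subrr.
  rewrite ltNge; apply/negP => MR; have := mlead_supp R0.
  rewrite mcoeff_msupp mcoeffB coefQtop ?lemc_mdeg // subr_eq0 => /eqP; apply.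
  move: MR; rewrite le_eqVlt => /predU1P[<-|/mcoeff_gt_mlead ->].
    by rewrite P1 rmorph1.
  by rewrite rmorph0.
rewrite subr_eq0 => /eqP QP.
have [M0|] := eqVneq M 0%MM.
  have PC : P = 1.
    have /msize1_polyC : (msize P <= 1)%N by rewrite -mlead_deg // -/M M0 mdeg0.
    by move=> PE; rewrite PE -mpolyC1; congr (_%:MP); rewrite -P1 M0.
  by move: Pf0; rewrite PC rmorph1 => /eqP; rewrite oner_eq0.
rewrite -mdeg_eq0 mdegE => M0.
have [i0 Mi0] : exists i, (0 < M i)%N.
  apply/existsP; apply: contraNT M0; rewrite negb_exists => /forallP M0.
  by rewrite big1 // => j _; apply/eqP; rewrite -leqn0 leqNgt.
have le_iM : (U_(i0) <= M)%MM by rewrite lep1mP -lt0n.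
pose N := (M - U_(i0))%MM.
have NM : (N + U_(i0) = M)%MM by rewrite submK.
have degN : (mdeg N).+1 = mdeg M by rewrite -NM mdegD mdeg1 addn1.
exists (fun i => P@_(N + U_(i)) *+ (N i).+1), (- P@_N); split.
- exists i0; rewrite NM P1; exact: char0.
- move=> i; rewrite rmorphMn /= -coefQtop ?QP //.
  by rewrite mdegD mdeg1 addn1 degN.
- have := coefQ N; rewrite degN leqnn QP => /(_ isT) PN.
  rewrite rmorphN opprK /= [X in _ = _ + X]PN addKr; apply: eq_bigr => i _.
  rewrite mulrC -coefQtop ?QP //.
  by rewrite mdegD mdeg1 addn1 degN.
Qed.

End AlgebraicDependence.

(** * Difference equations over k(s) *)

Section DifferenceEquation.
Context (k : fieldType) (rho : k).
Hypothesis char0 : forall n, n.+1%:R != 0 :> k.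
Hypothesis rho0 : rho != 0.
Hypothesis rho_inf : forall n, rho ^+ n.+1 != 1.
Implicit Types (p q A B N D : {poly k}) (f g : fps k).

Local Notation K := {fraction {poly k}}.
Local Notation F := {fraction (fps k)}.

Definition rat_fps : K -> F := frac_map (@poly_fps_inj k).

Lemma rat_fpsE p : rat_fps (tofrac p) = tofrac (poly_fps p).
Proof. exact: frac_map_tofrac. Qed.

Lemma fps_dil_inj : injective (fps_dil rho).
Proof.
move=> f g fg; apply: fpsP => n; have := congr1 (fun h => fps_coef h n) fg.
by rewrite !coef_dil => /(mulIf (expf_neq0 n rho0)).
Qed.

Lemma poly_dil_inj : injective (poly_dil rho).
Proof.
move=> p q pq; apply/poly_fps_inj/fps_dil_inj.
by rewrite !fps_dil_poly pq.
Qed.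

Definition rat_dil : K -> K := frac_map poly_dil_inj.
Definition frac_dil : F -> F := frac_map fps_dil_inj.
Lemma rat_dilE p : rat_dil (tofrac p) = tofrac (poly_dil rho p).
Proof. exact: frac_map_tofrac. Qed.
Lemma frac_dilE f : frac_dil (tofrac f) = tofrac (fps_dil rho f).
Proof. exact: frac_map_tofrac. Qed.

Arguments rat_fps : simpl never.
Arguments rat_dil : simpl never.
Arguments frac_dil : simpl never.
HB.instance Definition _ := GRing.RMorphism.on rat_fps.
HB.instance Definition _ := GRing.RMorphism.on rat_dil.
HB.instance Definition _ := GRing.RMorphism.on frac_dil.

Lemma rat_fps_dil r : rat_fps (rat_dil r) = frac_dil (rat_fps r).
Proof.
have [n [d [d0 ->]]] := fracP r.
rewrite !fmorph_div /=.
by rewrite !rat_dilE !rat_fpsE !frac_dilE !fps_dil_poly.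
Qed.

Lemma expr_rho_inj : injective (fun n => rho ^+ n).
Proof.
have aux m n : rho ^+ m = rho ^+ (m + n) -> n = 0%N.
  case: n => // n /eqP; rewrite exprD -{1}[rho ^+ m]mulr1 => /eqP.
  by move/(mulfI (expf_neq0 m rho0)) => /esym/eqP; rewrite (negPf (rho_inf n)).
move=> m n; case: (leqP m n) => [|/ltnW] /subnKC <- => [/aux ->|/esym/aux ->];
  by rewrite addn0.
Qed.

Lemma fps_coefM_low f g m n :
  (forall i, (i < m)%N -> fps_coef f i = 0) ->
  (forall i, (i < n)%N -> fps_coef g i = 0) ->
  fps_coef (f * g) (m + n) = fps_coef f m * fps_coef g n.
Proof.
move=> fm gn; rewrite fps_coefM.
have mP : (m < (m + n).+1)%N by rewrite ltnS leq_addr.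
rewrite (bigD1 (Ordinal mP)) //= addKn big1 ?addr0 // => i.
rewrite -val_eqE /= neq_ltn => /orP[/fm->|mi]; first by rewrite mul0r.
by rewrite [X in _ * X]gn ?mulr0 // ltn_subLR ?ltn_add2r // -ltnS.
Qed.

(** An invariant fraction n / d is the constant a for which n - a d has no term
at the order of d: otherwise comparing lowest terms would equate two distinct
powers of rho. *)
Lemma rat_dil_invariant r : rat_dil r = r -> exists a, r = tofrac a%:P.
Proof.
have [n [d [d0 ->]]] := fracP r; rewrite fmorph_div /= !rat_dilE => /eqP.
rewrite eqr_div ?tofrac_eq0 //; last first.
  by rewrite -(inj_eq poly_dil_inj) rmorph0 in d0.
rewrite -!rmorphM tofrac_eq => /eqP nd.
have fd0 : poly_fps d != 0 by rewrite -(inj_eq (@poly_fps_inj k)) rmorph0 in d0.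
have [l dl minl] := fps_order fd0.
have [a al] : exists a, n`_l = a * d`_l by exists (n`_l / d`_l); rewrite mulfVK.
exists a.
apply: (canLR (mulfK _)); first by rewrite tofrac_eq0.
rewrite -rmorphM; congr tofrac; apply/eqP; rewrite -subr_eq0; apply/negPn/negP.
pose u := n - a%:P * d; rewrite -/u -(inj_eq (@poly_fps_inj k)) rmorph0.
move=> /fps_order[j uj minj].
have ul : u`_l = 0 by rewrite coefB coefCM al subrr.
have ud : poly_fps u * fps_dil rho (poly_fps d)
    = fps_dil rho (poly_fps u) * poly_fps d.
  rewrite !fps_dil_poly -!rmorphM; congr poly_fps.
  rewrite /u rmorphB rmorphM /=. rewrite poly_dilC mulrBl mulrBl -nd.
  by congr (_ - _); rewrite -!mulrA [d * _]mulrC.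
have dil0 g i : fps_coef g i = 0 -> fps_coef (fps_dil rho g) i = 0.
  by rewrite coef_dil => ->; rewrite mul0r.
have := congr1 (fun g => fps_coef g (j + l)) ud.
rewrite fps_coefM_low // => [|i il]; last by rewrite dil0 ?minl.
rewrite fps_coefM_low // => [|i ij]; last by rewrite dil0 ?minj.
rewrite !coef_dil [RHS]mulrAC -[RHS]mulrA [_ * rho ^+ l]mulrC.
rewrite [X in _ = _ * X]mulrC => /(mulfI uj)/(mulIf dl)/expr_rho_inj lj.
by move: uj; rewrite -lj /= ul eqxx.
Qed.

(** * Poles *)

(** The order of the pole of r at z is at most m: as B does not vanish at z,
r = A / ((X - z)^m B). Products are compared rather than quotients in order to
treat fractions and series alike. *)
Definition pole_le m z (r : K) := exists A B,
  B.[z] != 0 /\ r * tofrac (('X - z%:P) ^+ m * B) = tofrac A.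

Definition fps_pole_le m z g := exists A B,
  B.[z] != 0 /\ g * poly_fps (('X - z%:P) ^+ m * B) = poly_fps A.

(** For m > 0 the order of the pole is exactly m, as neither A nor B vanishes
at z. *)
Definition fps_pole_eq m z g := exists A B,
  [/\ A.[z] != 0, B.[z] != 0
    & g * poly_fps (('X - z%:P) ^+ m * B) = poly_fps A].

(** A rational function may be given by a fraction or by its expansion at 0. *)
Lemma pole_leE m z r g : rat_fps r = tofrac g ->
  pole_le m z r <-> fps_pole_le m z g.
Proof.
move=> rg; split=> -[A [B [Bz E]]]; exists A, B; split=> //; last first.
  by apply: (fmorph_inj rat_fps); rewrite rmorphM /= !rat_fpsE rg -E tofracM.
apply/eqP; rewrite -tofrac_eq -rat_fpsE -E tofracM [X in _ == X]rmorphM /=.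
by rewrite rat_fpsE rg.
Qed.

Lemma pole_leD m z r s : pole_le m z r -> pole_le m z s -> pole_le m z (r + s).
Proof.
move=> [A [B [Bz rE]]] [A' [B' [B'z sE]]]; exists (A * B' + A' * B), (B * B').
split; first by rewrite hornerM mulf_neq0.
rewrite rmorphD !rmorphM /= -rE -sE !rmorphM /=; ring.
Qed.

Lemma pole_leZ m z a r : pole_le m z r -> pole_le m z (tofrac a%:P * r).
Proof.
move=> [A [B [Bz rE]]]; exists (a%:P * A), B; split=> //.
by rewrite -mulrA rE rmorphM.
Qed.

Lemma pole_leB m z r s : pole_le m z r -> pole_le m z s -> pole_le m z (r - s).
Proof.
move=> r_m /(pole_leZ (-1)); rewrite rmorphN rmorph1 rmorphN rmorph1 mulN1r.
exact: pole_leD.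
Qed.

Lemma pole_le0 m z : pole_le m z 0.
Proof. by exists 0, 1; rewrite hornerC oner_eq0 mul0r rmorph0. Qed.

Lemma pole_leW m n z r : (m <= n)%N -> pole_le m z r -> pole_le n z r.
Proof.
move=> /subnKC <- [A [B [Bz rE]]]; exists (A * ('X - z%:P) ^+ (n - m)), B.
split=> //; rewrite [RHS]tofracM -rE -mulrA -tofracM; congr (_ * tofrac _).
by rewrite exprD; ring.
Qed.

(** The dilation moves the poles by a factor 1 / rho. *)
Lemma pole_le_dil m z r : pole_le m (rho * z) r <-> pole_le m z (rat_dil r).
Proof.
have dilX : poly_dil rho ('X - (rho * z)%:P) = rho *: ('X - z%:P).
  by rewrite rmorphB /= poly_dilX poly_dilC scalerBr -[rho *: z%:P]mul_polyC polyCM.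
split=> -[A [B [Bz rE]]].
  exists (poly_dil rho A), (rho ^+ m *: poly_dil rho B).
  split; first by rewrite hornerZ horner_dil mulf_neq0 ?expf_neq0.
  rewrite -[RHS]rat_dilE -rE [RHS]rmorphM /= rat_dilE; congr (_ * tofrac _).
  rewrite rmorphM rmorphXn /= dilX exprZn.
  by rewrite -scalerAl -scalerAr.
have dilK p : poly_dil rho (poly_dil rho^-1 p) = p.
  rewrite /poly_dil -comp_polyA comp_polyZ comp_polyX scalerA mulVf // scale1r.
  by rewrite comp_polyXr.
exists (poly_dil rho^-1 A), ((rho ^- m) *: poly_dil rho^-1 B).
split.
  by rewrite hornerZ horner_dil mulKf ?mulf_neq0 ?invr_neq0 ?expf_neq0.
apply: (fmorph_inj rat_dil); rewrite rmorphM /= !rat_dilE dilK -rE.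
congr (_ * tofrac _); rewrite rmorphM rmorphXn /= dilX exprZn.
rewrite /poly_dil comp_polyZ -!/(poly_dil _ _) dilK -scalerAl -scalerAr scalerA.
by rewrite divff ?scale1r ?expf_neq0.
Qed.

(** A root of D among the w_n is split off by the factor theorem, and it is taken
by a single index. *)
Lemma eventually_nonroot (w : nat -> k) D : injective w -> D != 0 ->
  exists n0, forall n, (n0 <= n)%N -> D.[w n] != 0.
Proof.
move=> w_inj; have [s] := ubnP (size D); elim: s D => // s IHs D sD D0.
have [[n /factor_theorem[D' DE]]|noroot] := pselect (exists n, root D (w n));
  last first.
  by exists 0%N => n _; apply: contra_notN noroot => Dn; exists n.
have D'0 : D' != 0 by apply: contraNneq D0; rewrite DE => ->; rewrite mul0r.
have sD' : (size D' < s)%N.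
  by move: sD; rewrite DE size_Mmonic ?monicXsubC // size_XsubC addn2.
have [n0 D'n] := IHs _ sD' D'0; exists (maxn n0 n.+1) => j.
rewrite geq_max => /andP[nj jn]; rewrite DE hornerM mulf_neq0 ?D'n //.
rewrite hornerXsubC subr_eq0; apply: contraTneq jn => /w_inj ->.
by rewrite ltnn.
Qed.

Lemma eventually_regular (w : nat -> k) m r : injective w ->
  exists n0, forall n, (n0 <= n)%N -> pole_le m (w n) r.
Proof.
move=> w_inj; have [N [D [D0 ->]]] := fracP r.
have [n0 Dn] := eventually_nonroot w_inj D0; exists n0 => n /Dn Dw.
apply: (@pole_leW 0) => //; exists N, D; split=> //.
by rewrite expr0 mul1r mulfVK ?tofrac_eq0.
Qed.

Let downward (P : nat -> Prop) n0 : (forall n, (n0 <= n)%N -> P n) ->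
  (forall n, P n.+1 -> P n) -> forall n, P n.
Proof.
move=> Pn0 Pdown n; have [/Pn0 //|/ltnW/subnKC n_n0] := leqP n0 n.
have := Pn0 n0 (leqnn _); rewrite -n_n0; elim: (n0 - n)%N => [|d IHd].
  by rewrite addn0.
by rewrite addnS => /Pdown.
Qed.

(** A difference h(rho s) - h(s) cannot have a single pole of order > m on the
orbit of z: being regular far away on both sides of the orbit, h would
successively be of order at most m at all points on either side of z, up to
rho z and z themselves. *)
Lemma no_lone_pole m z h : z != 0 ->
  (forall n, pole_le m (rho ^+ n.+1 * z) (rat_dil h - h)) ->
  (forall n, pole_le m (rho ^- n.+1 * z) (rat_dil h - h)) ->
  pole_le m z (rat_dil h - h).
Proof.
move=> z0 Gpos Gneg.
have hpos n : pole_le m (rho ^+ n.+1 * z) h.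
  have inj : injective (fun n => rho ^+ n.+1 * z).
    by move=> i j /(mulIf z0)/expr_rho_inj [].
  have [n0 hn0] := eventually_regular m h inj.
  apply: (downward hn0) => i; rewrite exprS -mulrA => /pole_le_dil h_i.
  by have := pole_leB h_i (Gpos i); rewrite opprB addrC subrK.
have hneg n : pole_le m (rho ^- n * z) h.
  have inj : injective (fun n => rho ^- n * z).
    by move=> i j /(mulIf z0)/invr_inj/expr_rho_inj.
  have [n0 hn0] := eventually_regular m h inj.
  apply: (downward hn0) => i h_i.
  have := pole_leD (Gneg i) h_i; rewrite subrK => /pole_le_dil.
  by rewrite exprS invfM -mulrA mulVKf.
apply: pole_leB; last by have := hneg 0%N; rewrite expr0 invr1 mul1r.
by apply/pole_le_dil; have := hpos 0%N; rewrite expr1.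
Qed.

(** * Independence of the derivatives of a solution *)

(** The quotient rule for A / ((X - z)^m B), cleared of denominators. At z the
numerator takes the value - m z A(z) B(z). *)
Lemma euler_pole m z g A B :
  g * poly_fps (('X - z%:P) ^+ m * B) = poly_fps A ->
  euler g * poly_fps (('X - z%:P) ^+ m.+1 * B ^+ 2) =
  poly_fps ('X * A^`() * ('X - z%:P) * B -
            A * (m%:R * 'X * B + ('X - z%:P) * ('X * B^`()))).
Proof.
set pi := 'X - z%:P => gE.
have := congr1 (fun h => euler h * poly_fps (pi * B)) gE.
have pim : pi * (pi ^+ m)^`() = m%:R * pi ^+ m.
  case: m {gE} => [|m]; first by rewrite expr0 derivC mulr0 mul0r.
  by rewrite deriv_exp derivXsubC mul1r mulrnAr -exprS /= mulr_natl.
rewrite eulerM !euler_poly mulrDl derivM => H.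
have -> : 'X * A^`() * pi * B - A * (m%:R * 'X * B + pi * ('X * B^`())) =
  'X * A^`() * (pi * B) - A * (m%:R * 'X * B + pi * ('X * B^`())) by ring.
rewrite [RHS]rmorphB /= [poly_fps (_ * (pi * B))]rmorphM /= -H.
rewrite [poly_fps (A * _)]rmorphM /= -gE.
have -> : g * poly_fps ('X * ((pi ^+ m)^`() * B + pi ^+ m * B^`()))
    * poly_fps (pi * B)
    = g * poly_fps (pi ^+ m * B) * poly_fps (m%:R * 'X * B + pi * ('X * B^`())).
  rewrite -!mulrA -!rmorphM; congr (_ * poly_fps _).
  transitivity ('X * B * ((pi * (pi ^+ m)^`()) * B + pi * pi ^+ m * B^`())).
    by ring.
  by rewrite pim; ring.
by rewrite addrK -mulrA -rmorphM; congr (_ * poly_fps _); rewrite exprS; ring.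
Qed.

Lemma fps_pole_leW m n z g :
  (m <= n)%N -> fps_pole_le m z g -> fps_pole_le n z g.
Proof.
move=> /subnKC <- [A [B [Bz gE]]]; exists (A * ('X - z%:P) ^+ (n - m)), B.
split=> //; rewrite [RHS]rmorphM /= -gE -mulrA -rmorphM.
by congr (_ * poly_fps _); rewrite exprD; ring.
Qed.

Lemma fps_pole_le_euler m z g :
  fps_pole_le m z g -> fps_pole_le m.+1 z (euler g).
Proof.
move=> [A [B [Bz gE]]]; eexists; exists (B ^+ 2).
by split; [rewrite horner_exp expf_neq0|exact: euler_pole gE].
Qed.

(** Here z <> 0 and characteristic 0 are used: by euler_pole the numerator of
s g'(s) at z is a nonzero multiple of (m + 1) z. *)
Lemma fps_pole_eq_euler m z g : z != 0 ->
  fps_pole_eq m.+1 z g -> fps_pole_eq m.+2 z (euler g).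
Proof.
move=> z0 [A [B [Az Bz gE]]]; eexists; exists (B ^+ 2).
split; [|by rewrite horner_exp expf_neq0|exact: euler_pole gE].
have nE : (m.+1%:R : {poly k}).[z] = m.+1%:R by rewrite -polyC_natr hornerC.
rewrite !(hornerD, hornerN, hornerM) nE !hornerX hornerC subrr.
rewrite !(mulr0, mul0r) addr0 sub0r oppr_eq0.
by rewrite !mulf_neq0.
Qed.

Lemma fps_pole_eq_le m z g : fps_pole_eq m.+1 z g -> ~ fps_pole_le m z g.
Proof.
move=> [A [B [Az Bz gE]]] [A' [B' [B'z gE']]].
have /poly_fps_inj : poly_fps (A * B') = poly_fps (A' * (('X - z%:P) * B)).
  rewrite !rmorphM /= -gE -gE' -!mulrA -!rmorphM.
  by congr (_ * poly_fps _); rewrite exprS; ring.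
move/(congr1 (horner^~ z)); rewrite !hornerM hornerXsubC subrr mul0r mulr0.
by move/eqP; rewrite mulf_eq0 (negPf Az) (negPf B'z).
Qed.

Definition fps_rational g := exists N D,
  D != 0 /\ g * poly_fps D = poly_fps N.

Lemma fps_rationalP g : fps_rational g -> exists r, rat_fps r = tofrac g.
Proof.
move=> [N [D [D0 gE]]]; exists (tofrac N / tofrac D).
rewrite fmorph_div /= !rat_fpsE -gE rmorphM mulfK // tofrac_eq0.
by rewrite -(inj_eq (@poly_fps_inj k)) rmorph0 in D0.
Qed.

Lemma fps_rational_euler g : fps_rational g -> fps_rational (euler g).
Proof.
move=> [N [D [D0 gE]]].
have gE' : g * poly_fps (('X - 0%:P) ^+ 0 * D) = poly_fps N.
  by rewrite expr0 mul1r.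
have := euler_pole gE'; eexists; eexists; split; last eassumption.
by rewrite mulf_neq0 ?expf_neq0 // polyXsubC_eq0.
Qed.

(** By difference_ostrowski a relation between the derivatives of f gives
constants c_i, not all zero, and h with
sum_i c_i (s d/ds)^i b = h(rho s) - h(s). Let M be the largest index with
c_M <> 0. At z the left-hand side has a pole of order m + 1 + M exactly, and at
the other points of the orbit a pole of order at most m + M, contradicting
no_lone_pole. *)
Theorem lone_pole_euler_independent f m z n : z != 0 ->
  let b := fps_dil rho f - f in
  fps_rational b -> fps_pole_eq m.+1 z b ->
  (forall i, fps_pole_le m (rho ^+ i.+1 * z) b) ->
  (forall i, fps_pole_le m (rho ^- i.+1 * z) b) ->
  ~ alg_dependent rat_fps (fun i : 'I_n => tofrac (iter i (@euler k) f)).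
Proof.
move=> z0 b b_rat b_z b_pos b_neg dep.
have bi_rat i : fps_rational (iter i (@euler k) b).
  by elim: i => //= i; apply: fps_rational_euler.
have bi_le y i : fps_pole_le m y b -> fps_pole_le (m + i) y (iter i (@euler k) b).
  move=> b_y; elim: i => [|i IHi]; first by rewrite addn0.
  by rewrite addnS; apply: fps_pole_le_euler.
have bi_eq i : fps_pole_eq (m + i).+1 z (iter i (@euler k) b).
  elim: i => [|i IHi]; first by rewrite addn0.
  by rewrite addnS; apply: fps_pole_eq_euler.
have [r rE] := choice (fun i => fps_rationalP (bi_rat i)).
have dilE i : frac_dil (tofrac (iter i (@euler k) f)) =
    tofrac (iter i (@euler k) f) + rat_fps (r i).
  rewrite rE frac_dilE -tofracD; congr tofrac; rewrite /b.
  elim: i {rE} => [|i /= IHi]; first by rewrite addrC subrK.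
  by rewrite -euler_dil IHi eulerD.
have charK i : i.+1%:R != 0 :> K.
  have -> : i.+1%:R = tofrac (i.+1%:R)%:P :> K by rewrite polyC_natr rmorph_nat.
  by rewrite tofrac_eq0 polyC_eq0.
have [c [h [[i0 ci0] c_inv cE]]] := @difference_ostrowski _ _ _ n rat_dil frac_dil _
  (fun i => r i) rat_fps_dil (fun i => dilE i) charK dep.
have [a aE] := choice (fun i => rat_dil_invariant (c_inv i)).
pose M : 'I_n := [arg max_(i > i0 | c i != 0) val i].
have [cM Mmax] : c M != 0 /\ forall j, c j != 0 -> (j <= M)%N.
  by rewrite /M; case: arg_maxnP.
have sum_le y : (forall i : 'I_n, (i < M)%N || (i == M) && (c i != 0) ->
    pole_le (m + M) y (r i)) -> pole_le (m + M) y (\sum_i c i * r i).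
  move=> r_y; apply: big_ind => [||i _]; [exact: pole_le0|exact: pole_leD|].
  have [->|ci] := eqVneq (c i) 0; first by rewrite mul0r; apply: pole_le0.
  rewrite aE; apply/pole_leZ/r_y; rewrite ci andbT -val_eqE orbC -leq_eqVlt.
  exact: Mmax.
have orbit_le y : fps_pole_le m y b -> pole_le (m + M) y (rat_dil h - h).
  move=> b_y; rewrite -cE; apply: sum_le => i iM.
  apply: (@pole_leW (m + i)); last exact/(pole_leE _ _ (rE i))/bi_le.
  by rewrite leq_add2l leq_eqVlt; case/orP: iM => [->|/andP[/eqP-> _]];
    rewrite ?orbT ?eqxx.
have := @no_lone_pole (m + M) z h z0 (fun i => orbit_le _ (b_pos i))
  (fun i => orbit_le _ (b_neg i)).
rewrite -cE (bigD1 M) //= => G_z.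
have rest_z : pole_le (m + M) z (\sum_(i < n | i != M) c i * r i).
  apply: big_ind => [||i iM]; [exact: pole_le0|exact: pole_leD|].
  have [->|ci] := eqVneq (c i) 0; first by rewrite mul0r; apply: pole_le0.
  have {iM} lt_iM : (i < M)%N by rewrite ltn_neqAle val_eqE iM Mmax.
  rewrite aE; apply/pole_leZ/(@pole_leW (m + i).+1); first by rewrite ltn_add2l.
  apply/(pole_leE _ _ (rE i)); have [A [B [_ Bz gE]]] := bi_eq i.
  by exists A, B.
have := pole_leZ (a M)^-1 (pole_leB G_z rest_z); rewrite addrK mulrA aE -rmorphM.
rewrite -rmorphM mulVf /= ?rmorph1 ?mul1r; last first.
  by apply: contraNneq cM => aM; rewrite aE aM !rmorph0.
by move/(pole_leE _ _ (rE M))/(fps_pole_eq_le (bi_eq M)).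
Qed.

(** The Q_i stand for the successive derivatives of a function of a variable v,
evaluated at v = u(s). Dividing by the derivative of u, the chain rule expresses
each Q_i as an affine combination of f, ..., (s d/ds)^i f over k(s), whose
coefficient at the last of these is nonzero. The matrix of the system is
triangular and invertible, so independence is inherited from f. *)
Theorem composite_independent f m z n (u : fps k) (Q : nat -> fps k)
    (E e T : {poly k}) : z != 0 ->
  let b := fps_dil rho f - f in
  fps_rational b -> fps_pole_eq m.+1 z b ->
  (forall i, fps_pole_le m (rho ^+ i.+1 * z) b) ->
  (forall i, fps_pole_le m (rho ^- i.+1 * z) b) ->
  fps_rational u -> euler u != 0 ->
  (forall i, euler (Q i) = Q i.+1 * euler u) ->
  E != 0 -> T != 0 ->
  Q 0%N * poly_fps E = poly_fps T * f + poly_fps e ->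
  ~ alg_dependent rat_fps (fun i : 'I_n => tofrac (Q i)).
Proof.
move=> z0 b b_rat b_z b_pos b_neg u_rat u'0 Qu E0 T0 QE.
(* Row i of the triangular system, cleared of denominators. *)
suff aff i : exists E e (T : nat -> {poly k}), [/\ E != 0, T i != 0,
    forall j, (i < j)%N -> T j = 0
  & Q i * poly_fps E =
    \sum_(j < i.+1) poly_fps (T j) * iter j (@euler k) f + poly_fps e].
  have [E_ E_P] := choice aff; have [e_ e_P] := choice E_P.
  have [T_ T_P] := choice e_P.
  pose TM := \matrix_(i < n, j < n) (tofrac (T_ i j) / tofrac (E_ i) : K).
  have TMu : TM \in unitmx.
    rewrite unitmxE unitfE det_trig; last first.
      apply/is_trig_mxP => i j ij; rewrite mxE.
      by case: (T_P i) => _ _ -> //; rewrite rmorph0 mul0r.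
    apply/prodf_neq0 => i _; case: (T_P i) => Ei Ti _ _.
    by rewrite mxE mulf_neq0 ?invr_neq0 // tofrac_eq0.
  move/(alg_dependent_affine (f := fun i : 'I_n => tofrac (iter i (@euler k) f))
    (e := fun i => tofrac (e_ i) / tofrac (E_ i)) TMu) => dep.
  apply: (lone_pole_euler_independent z0 b_rat b_z b_pos b_neg (n := n)).
  apply: dep => i; case: (T_P i) => Ei Ti Tgt.
  have fEi : tofrac (poly_fps (E_ i)) != 0 :> F.
    by rewrite tofrac_eq0 -(inj_eq (@poly_fps_inj k)) rmorph0 in Ei *.
  move=> QiE; apply: (mulIf fEi); rewrite -tofracM QiE tofracD.
  rewrite mulrDl fmorph_div /= !rat_fpsE mulfVK //; congr (_ + _).
  rewrite raddf_sum mulr_suml (big_ord_widen n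
    (fun j => tofrac (poly_fps (T_ i j) * iter j (@euler k) f))) //.
  rewrite big_mkcond; apply: eq_bigr => j _; rewrite mxE fmorph_div /= !rat_fpsE.
  rewrite ltnS; case: leqP => [_|/Tgt ->].
    by rewrite tofracM mulrAC mulfVK.
  by rewrite !rmorph0 !mul0r.
have [N [D [D0 uE]]] := u_rat.
have fD0 : poly_fps D != 0 by rewrite -(inj_eq (@poly_fps_inj k)) rmorph0 in D0.
(* The derivative of u = N / D is U / D^2. *)
pose U := 'X * N^`() * D - N * ('X * D^`()).
have UE : euler u * poly_fps (D ^+ 2) = poly_fps U.
  have gE : u * poly_fps (('X - 0%:P) ^+ 0 * D) = poly_fps N.
    by rewrite expr0 mul1r.
  have := congr1 (@euler k) uE; rewrite eulerM !euler_poly => H.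
  have -> : poly_fps (D ^+ 2) = poly_fps D * poly_fps D.
    by rewrite -rmorphM.
  rewrite mulrA; move/(canRL (addrK _)): H => ->.
  rewrite mulrBl mulrAC uE -!rmorphM -rmorphB; congr poly_fps; rewrite /U; ring.
have U0 : U != 0.
  rewrite -(inj_eq (@poly_fps_inj k)) -UE rmorph0 mulf_neq0 //.
  by rewrite rmorphXn expf_neq0.
clearbody U.
elim: i => [|i [Ei [ei [Ti [Ei0 Tii Tgt QiE]]]]].
  exists E, e, (fun j => if j == 0%N then T else 0); split=> // [[]//|].
  by rewrite big_ord1 QE.
have [d dE] : exists d : {poly k} -> {poly k}, forall p, d p = 'X * p^`().
  by exists (fun p => 'X * p^`()).
have d0 : d 0 = 0 by rewrite dE deriv0 mulr0.
pose Tpred j := if j is j'.+1 then Ti j' else 0.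
(* Differentiate Q_i E_i = sum_j T_j f^(j) + e_i, multiply by E_i to replace
Q_i E_i once more, and divide by u' = U / D^2; the term E_i T_(j-1) comes from the
derivatives of the f^(j). *)
exists (Ei ^+ 2 * U), (D ^+ 2 * (Ei * d ei - d Ei * ei)),
  (fun j => D ^+ 2 * (Ei * d (Ti j) + Ei * Tpred j - d Ei * Ti j)); split.
- by rewrite mulf_neq0 ?expf_neq0.
- rewrite /= Tgt // d0 !mulr0 subr0 add0r.
  by rewrite !mulf_neq0 ?expf_neq0.
- by case=> [//|j] ij; rewrite /= !Tgt ?(ltnW ij) // d0 !mulr0 subr0 addr0 mulr0.
have := congr1 (@euler k) QiE; rewrite eulerD euler_poly -dE.
have eulerS (s : seq nat) (G : nat -> fps k) :
    euler (\sum_(j <- s) G j) = \sum_(j <- s) euler (G j).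
  elim: s => [|j s IHs]; last by rewrite !big_cons eulerD IHs.
  by rewrite !big_nil /euler -(rmorph0 (@poly_fps k)) fps_deriv_poly deriv0 !rmorph0 mulr0.
rewrite -(big_mkord xpredT (fun j => poly_fps (Ti j) * iter j (@euler k) f)).
rewrite eulerS; under eq_bigr => j _ do rewrite eulerM euler_poly -dE.
rewrite big_split /= eulerM euler_poly -dE Qu => H.
pose S := \sum_(0 <= j < i.+1) poly_fps (Ti j) * iter j (@euler k) f.
pose S1 := \sum_(0 <= j < i.+1) poly_fps (d (Ti j)) * iter j (@euler k) f.
pose S2 := \sum_(0 <= j < i.+1) poly_fps (Ti j) * euler (iter j (@euler k) f).
rewrite -/S1 -/S2 in H.
rewrite -(big_mkord xpredT (fun j => poly_fps
  (D ^+ 2 * (Ei * d (Ti j) + Ei * Tpred j - d Ei * Ti j)) * iter j (@euler k) f)).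
have -> : \sum_(0 <= j < i.+2) poly_fps (D ^+ 2 *
    (Ei * d (Ti j) + Ei * Tpred j - d Ei * Ti j)) * iter j (@euler k) f =
    poly_fps (D ^+ 2) * (poly_fps Ei * S1 + poly_fps Ei * S2 - poly_fps (d Ei) * S).
  have -> : S = \sum_(0 <= j < i.+2) poly_fps (Ti j) * iter j (@euler k) f.
    by rewrite [RHS]big_nat_recr //= Tgt // rmorph0 mul0r addr0.
  have -> : S1 = \sum_(0 <= j < i.+2) poly_fps (d (Ti j)) * iter j (@euler k) f.
    by rewrite [RHS]big_nat_recr //= Tgt // d0 rmorph0 mul0r addr0.
  have -> : S2 = \sum_(0 <= j < i.+2) poly_fps (Tpred j) * iter j (@euler k) f.
    by rewrite [RHS]big_nat_recl //= rmorph0 mul0r add0r.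
  rewrite !mulr_sumr -big_split -sumrB mulr_sumr; apply: eq_bigr => j _ /=.
  by rewrite rmorphM rmorphB rmorphD !rmorphM /=; ring.
have QiE' : Q i * poly_fps Ei = S + poly_fps ei.
  by rewrite QiE /S big_mkord.
rewrite !rmorphM rmorphB !rmorphM /= -UE !rmorphXn /=.
transitivity (poly_fps D ^+ 2 * poly_fps Ei *
   ((Q i.+1 * euler u * poly_fps Ei + Q i * poly_fps (d Ei)))
   - poly_fps D ^+ 2 * poly_fps (d Ei) * (Q i * poly_fps Ei)).
  by ring.
by rewrite H QiE'; ring.
Qed.

End DifferenceEquation.

(** * Rational parametrization of the kernel curve *)

Section KernelIdentities.
Context (A : comNzRingType).

(** With P1 = ptP a b be x1 x2 y1 y2, P2 the same with y1 and y2 exchanged,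
Q1 = ptQ a b be x1 x2 y1 y2 and Q2 the same with x1 and x2 exchanged, the curve is
parametrized by

   x = w^2 s / (b (s - P1) (s - P2)),  y = w^2 s / (a be (s - Q1) (s - Q2)),
   w = b - a be^2.

The scaling of s is chosen so that the P_i and Q_i are polynomials in be. *)
Definition ptP (a b be x1 x2 y1 y2 : A) :=
  be * (b * y2 + a * (x1 + x2) * be + a * y1 * be ^+ 2).
Definition ptQ (a b be x1 x2 y1 y2 : A) :=
  b * x1 + b * (y1 + y2) * be + a * x2 * be ^+ 2.

(** be / t times the kernel of the walk. The d_(i,j) are expressed by the roots of
the quadratic polynomials that they form along the line of the points (i, 1), and
along that of the points (1, j): a z^2 + d_(0,1) z + d_(1,1) = a (z - x1) (z - x2),
b z^2 + d_(1,0) z + d_(1,1) = b (z - y1) (z - y2). The weight d_(0,0) is eliminated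
by the equation of be. *)
Definition kernel (a b be x1 x2 y1 y2 x y : A) :=
  (a * be ^+ 2 + b) * x * y
  - be * (a * y ^+ 2 - a * (x1 + x2) * x * y ^+ 2 + a * x1 * x2 * x ^+ 2 * y ^+ 2
          - b * (y1 + y2) * x ^+ 2 * y + b * x ^+ 2).

(** P1 P2 = Q1 Q2 / rho: the constant terms of the two denominators are related,
which turns the equation of the curve into a polynomial identity. *)
Lemma ptPM (a b be x1 x2 y1 y2 : A) :
  a * x1 * x2 = b * y1 * y2 ->
  b * (ptP a b be x1 x2 y1 y2 * ptP a b be x1 x2 y2 y1) =
  a * be ^+ 2 * (ptQ a b be x1 x2 y1 y2 * ptQ a b be x2 x1 y1 y2).
Proof.
move=> xy; apply/eqP; rewrite -subr_eq0; apply/eqP.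
transitivity (- (b - a * be ^+ 2) ^+ 2 * (a * x1 * x2 - b * y1 * y2) * be ^+ 2).
  by rewrite /ptP /ptQ; ring.
by rewrite xy subrr mulr0 mul0r.
Qed.

Lemma kernel_homogeneous (a b be x1 x2 y1 y2 x y u v c d : A) :
  x * u = c -> y * v = d -> 
  kernel a b be x1 x2 y1 y2 x y * (u * v) ^+ 2 =
  (a * be ^+ 2 + b) * c * d * u * v
  - be * (a * d ^+ 2 * u ^+ 2 - a * (x1 + x2) * c * d ^+ 2 * u
          + a * x1 * x2 * c ^+ 2 * d ^+ 2
          - b * (y1 + y2) * c ^+ 2 * d * v + b * c ^+ 2 * v ^+ 2).
Proof. by move=> <- <-; rewrite /kernel; ring. Qed.

Variables (a b be x1 x2 y1 y2 s : A).
Local Notation P1 := (ptP a b be x1 x2 y1 y2).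
Local Notation P2 := (ptP a b be x1 x2 y2 y1).
Local Notation Q1 := (ptQ a b be x1 x2 y1 y2).
Local Notation Q2 := (ptQ a b be x2 x1 y1 y2).
Local Notation W := ((b - a * be ^+ 2) ^+ 2).

(** The denominators u of x and v of y are cleared by multiplying with (u v)^2. The
constant term of u is written with Q1 Q2 instead of P1 P2, by ptPM, which leaves a
polynomial identity in the parameters. *)
Lemma kernel_vanishes x y :
  GRing.lreg (b * s ^+ 2 - b * (P1 + P2) * s + a * be ^+ 2 * (Q1 * Q2)) ->
  GRing.lreg (a * be * (s ^+ 2 - (Q1 + Q2) * s + Q1 * Q2)) ->
  x * (b * s ^+ 2 - b * (P1 + P2) * s + a * be ^+ 2 * (Q1 * Q2)) = W * s ->
  y * (a * be * (s ^+ 2 - (Q1 + Q2) * s + Q1 * Q2)) = W * s ->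
  kernel a b be x1 x2 y1 y2 x y = 0.
Proof.
move=> ureg vreg xu yv; have uvreg := lregX (n := 2) (lregM ureg vreg).
apply: uvreg; rewrite mulr0 [LHS]mulrC.
apply: (etrans (kernel_homogeneous _ _ _ _ _ _ _ xu yv)).
by rewrite /ptP /ptQ; ring.
Qed.

(** The point (x(s), y(rho s)), with the denominator of y(rho s) multiplied by
(a be^2)^2 so that rho = b / (a be^2) does not appear. *)
Lemma kernel_vanishes_dil x y :
  GRing.lreg (b * s ^+ 2 - b * (P1 + P2) * s + a * be ^+ 2 * (Q1 * Q2)) ->
  GRing.lreg (b ^+ 2 * s ^+ 2 - a * b * be ^+ 2 * (Q1 + Q2) * s
              + a ^+ 2 * be ^+ 4 * (Q1 * Q2)) ->
  x * (b * s ^+ 2 - b * (P1 + P2) * s + a * be ^+ 2 * (Q1 * Q2)) = W * s ->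
  y * (b ^+ 2 * s ^+ 2 - a * b * be ^+ 2 * (Q1 + Q2) * s
       + a ^+ 2 * be ^+ 4 * (Q1 * Q2)) = b * be * W * s ->
  kernel a b be x1 x2 y1 y2 x y = 0.
Proof.
move=> ureg vreg xu yv; have uvreg := lregX (n := 2) (lregM ureg vreg).
apply: uvreg; rewrite mulr0 [LHS]mulrC.
apply: (etrans (kernel_homogeneous _ _ _ _ _ _ _ xu yv)).
by rewrite /ptP /ptQ; ring.
Qed.

End KernelIdentities.

Section PoleOrders.
Context (k : fieldType).
Implicit Types (g : fps k) (N B : {poly k}) (s : seq k).

Let prod_split s z : \prod_(r <- s) ('X - r%:P) =
  ('X - z%:P) ^+ count_mem z s * \prod_(r <- s | r != z) ('X - r%:P).
Proof.
rewrite (bigID (pred1 z)) /=; congr (_ * _).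
rewrite (eq_bigr (fun=> 'X - z%:P)) => [|r /eqP-> //].
by rewrite big_const_seq iter_mulr_1.
Qed.

Let horner_rest s z : (\prod_(r <- s | r != z) ('X - r%:P)).[z] != 0.
Proof.
rewrite horner_prod; elim/big_rec: _ => [|r x rz x0]; first exact: oner_neq0.
by rewrite mulf_neq0 // hornerXsubC subr_eq0 eq_sym.
Qed.

Lemma fps_pole_le_prod g N (c : k) s z : c != 0 ->
  g * poly_fps (c *: \prod_(r <- s) ('X - r%:P)) = poly_fps N ->
  fps_pole_le (count_mem z s) z g.
Proof.
move=> c0 gE; exists N, (c *: \prod_(r <- s | r != z) ('X - r%:P)).
by rewrite hornerZ mulf_neq0 ?horner_rest // -scalerAr -prod_split.
Qed.

Lemma fps_pole_eq_prod g N (c : k) s z : c != 0 ->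
  g * poly_fps (c *: \prod_(r <- s) ('X - r%:P)) = poly_fps N ->
  N.[z] != 0 -> fps_pole_eq (count_mem z s) z g.
Proof.
move=> c0 gE Nz; exists N, (c *: \prod_(r <- s | r != z) ('X - r%:P)).
by rewrite hornerZ mulf_neq0 ?horner_rest // -scalerAr -prod_split.
Qed.

Lemma count_mem_head (p : k) s : p \notin s -> count_mem p (p :: s) = 1%N.
Proof. by move=> /count_memPn sp; rewrite /= sp eqxx. Qed.

Lemma count_mem_aaabc (p q r u : k) : count_mem u [:: p; p; p; q; r] =
  ((p == u) * 3 + (q == u) + (r == u))%N.
Proof. by rewrite /=; case: (p == u); case: (q == u); case: (r == u). Qed.

Lemma count_mem_abcbad (p q r t u : k) : count_mem u [:: p; q; r; q; p; t] =
  ((p == u) * 2 + (q == u) * 2 + (r == u) + (t == u))%N.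
Proof.
by rewrite /=; case: (p == u); case: (q == u); case: (r == u); case: (t == u).
Qed.

(** The geometric series. *)
Lemma fps_inv_XsubC (p : k) : p != 0 ->
  exists g, g * poly_fps ('X - p%:P) = 1.
Proof.
move=> p0; exists (FPS (fun n => - p ^- n.+1)).
rewrite mulrC rmorphB /= poly_fpsX poly_fpsC mulrBl; apply: fpsP => n.
rewrite fps_coefD fps_coefN.
rewrite fps_coefCM fps_coefXM mulrN opprK.
case: n => [|n] /=; first by rewrite add0r expr1 divff.
by rewrite [p ^+ n.+2]exprS invfM mulrA divff // mul1r addNr.
Qed.

End PoleOrders.

Section Transcendence.
Context (k : fieldType) (j : {rmorphism rat -> k}) (be : k).
Hypothesis be_trans : ~ algebraicOver j be.

Let alg z := algebraicOver j z.

(** A root of a nonzero polynomial with algebraic coefficients is algebraic. *)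
Lemma transcendental_horner (A : {poly k}) :
  (forall i, alg A`_i) -> A != 0 -> A.[be] != 0.
Proof.
move=> algA A0; apply: contra_not_neq be_trans => Abe.
apply/integral_algebraic/(integral_root A0); first by apply/rootP.
by move=> c /(nthP 0)[i _ <-]; apply/integral_algebraic/algA.
Qed.

(** Orders in be are well defined: the polynomial X^m A - X^n B has a nonzero
coefficient of degree min(m, n) unless m = n, and then be is not one of its
roots. *)
Lemma transcendental_order (A B : {poly k}) (m n : nat) :
  (forall i, alg A`_i) -> (forall i, alg B`_i) -> A`_0 != 0 -> B`_0 != 0 ->
  be ^+ m * A.[be] = be ^+ n * B.[be] -> m = n.
Proof.
wlog lt_mn : A B m n / (m <= n)%N => [H|] algA algB A0 B0 E.
  have [mn|/ltnW nm] := leqP m n; first exact: (H A B).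
  exact/esym/(H B A).
move: lt_mn; rewrite leq_eqVlt => /predU1P[//|lt_mn].
pose D := 'X^m * A - 'X^n * B.
have : D.[be] != 0.
  apply: transcendental_horner => [i|].
    rewrite coefB !coefXnM; apply: algebraic_sub; case: ifP => _;
      by [exact: algebraic0 | exact: algA | exact: algB].
  apply/eqP => /(congr1 (fun p : {poly k} => p`_m)).
  rewrite coefB !coefXnM ltnn subnn lt_mn subr0 coef0 => /eqP.
  by rewrite (negPf A0).
by rewrite hornerD hornerN !hornerM !hornerXn E subrr eqxx.
Qed.

End Transcendence.

Lemma ptP_morph (A B : comNzRingType) (phi : {rmorphism A -> B}) a b be x1 x2 y1 y2 :
  phi (ptP a b be x1 x2 y1 y2) =
  ptP (phi a) (phi b) (phi be) (phi x1) (phi x2) (phi y1) (phi y2).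
Proof. by rewrite /ptP !(rmorphM, rmorphD, rmorphXn). Qed.

Lemma ptQ_morph (A B : comNzRingType) (phi : {rmorphism A -> B}) a b be x1 x2 y1 y2 :
  phi (ptQ a b be x1 x2 y1 y2) =
  ptQ (phi a) (phi b) (phi be) (phi x1) (phi x2) (phi y1) (phi y2).
Proof. by rewrite /ptQ !(rmorphM, rmorphD, rmorphXn). Qed.

Lemma even_neq_odd m n : (2 * m + 0 = 2 * n + 1)%N -> False.
Proof. lia. Qed.
Lemma even_neq_oddS m n : (2 * m + 2 = 2 * n + 1)%N -> False.
Proof. lia. Qed.
Lemma odd_eq_odd m n : (2 * m + 1 = 2 * n + 1)%N -> n = m.
Proof. lia. Qed.

Section Uniformization.
Context (k : fieldType) (j : {rmorphism rat -> k}) (a b be x1 x2 y1 y2 : k).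
Let alg z := algebraicOver j z.
Hypotheses (be_trans : ~ alg be) (alg_a : alg a) (alg_b : alg b).
Hypotheses (alg_x1 : alg x1) (alg_x2 : alg x2) (alg_y1 : alg y1) (alg_y2 : alg y2).
Hypotheses (a0 : a != 0) (b0 : b != 0) (xyE : a * x1 * x2 = b * y1 * y2).
Hypotheses (x10 : x1 != 0) (x2y2 : x2 = 0 -> y2 = 0).

Let rho := b / (a * be ^+ 2).
Let w := b - a * be ^+ 2.
Local Notation P1 := (ptP a b be x1 x2 y1 y2).
Local Notation P2 := (ptP a b be x1 x2 y2 y1).
Local Notation Q1 := (ptQ a b be x1 x2 y1 y2).
Local Notation Q2 := (ptQ a b be x2 x1 y1 y2).

Let be0 : be != 0.
Proof. by apply: contra_not_neq be_trans => ->; apply: algebraic0. Qed.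

Let q3 c0 c1 c2 : {poly k} := c0%:P + c1 *: 'X + c2 *: 'X^2.

Let q3_coef c0 c1 c2 i : (q3 c0 c1 c2)`_i =
  if i is i1.+1 then if i1 is i2.+1 then if i2 is 0 then c2 else 0 else c1 else c0.
Proof.
rewrite !coefD coefC !coefZ coefX coefXn.
by case: i => [|[|[|i]]] /=; rewrite ?(mulr0, mulr1, addr0, add0r).
Qed.

Let alg_q3 c0 c1 c2 : alg c0 -> alg c1 -> alg c2 -> forall i, alg (q3 c0 c1 c2)`_i.
Proof.
move=> A0 A1 A2 i; rewrite q3_coef.
by case: i => [|[|[|i]]] //; apply: algebraic0.
Qed.

Let q3E c0 c1 c2 z : (q3 c0 c1 c2).[z] = c0 + c1 * z + c2 * z ^+ 2.
Proof. by rewrite !hornerE. Qed.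

Let alg_M z t : alg z -> alg t -> alg (z * t). Proof. exact: algebraic_mul. Qed.
Let alg_D z t : alg z -> alg t -> alg (z + t). Proof. exact: algebraic_add. Qed.
Let alg_X z n : alg z -> alg (z ^+ n).
Proof.
move=> algz; elim: n => [|n IHn]; first by rewrite expr0; apply: algebraic1.
by rewrite exprS; apply: alg_M.
Qed.
Let alg_0 : alg 0. Proof. exact: algebraic0. Qed.

Let rho_fac : rho * (a * be ^+ 2) = b.
Proof. by rewrite mulfVK // mulf_neq0 ?expf_neq0. Qed.

Lemma dilation_neq0 : rho != 0.
Proof. by rewrite mulf_neq0 ?invr_neq0 ?mulf_neq0 ?expf_neq0. Qed.
Let rho0 := dilation_neq0.

(** Equality of two points of the orbits of u and v is an equation between
polynomials in be. As rho has order -2, it forces the orders m and n of u and v to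
be congruent modulo 2, with a prescribed difference. *)
Let orbit_order (A B : {poly k}) u v m n i l :
  (forall i, alg A`_i) -> (forall i, alg B`_i) -> A`_0 != 0 -> B`_0 != 0 ->
  u = be ^+ m * A.[be] -> v = be ^+ n * B.[be] ->
  rho ^+ i * u = rho ^+ l * v -> (2 * l + m = 2 * i + n)%N.
Proof.
move=> algA algB A0 B0 -> -> E; pose al := a * be ^+ 2.
apply: (@transcendental_order _ _ _ be_trans
  ((b ^+ i * a ^+ l) *: A) ((b ^+ l * a ^+ i) *: B)).
- by move=> h; rewrite coefZ; do ?[apply: alg_M|exact: alg_X].
- by move=> h; rewrite coefZ; do ?[apply: alg_M|exact: alg_X].
- by rewrite coefZ !mulf_neq0 ?expf_neq0.
- by rewrite coefZ !mulf_neq0 ?expf_neq0.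
transitivity (al ^+ (i + l) * (rho ^+ i * (be ^+ m * A.[be]))).
  by rewrite hornerZ -[in LHS]rho_fac [be ^+ _]exprD exprM [al ^+ _]exprD !exprMn; ring.
by rewrite E hornerZ -[in RHS]rho_fac [be ^+ (_ + n)]exprD exprM [al ^+ _]exprD !exprMn; ring.
Qed.

Lemma dilation_infinite n : rho ^+ n.+1 != 1.
Proof.
apply/eqP => E; have := @orbit_order 1 1 1 1 0 0 n.+1 0.
rewrite coef1 hornerC !mulr1 expr0 oner_neq0 => H.
have alg1 i : alg ((1 : {poly k})`_i).
  by rewrite coef1; case: (i == 0); [apply: algebraic1 | apply: algebraic0].
by have := H alg1 alg1 isT isT erefl erefl E.
Qed.

Let P1E : P1 = be ^+ 1 * (q3 (b * y2) (a * (x1 + x2)) (a * y1)).[be].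
Proof. by rewrite q3E. Qed.
Let P2E : P2 = be ^+ 1 * (q3 (b * y1) (a * (x1 + x2)) (a * y2)).[be].
Proof. by rewrite q3E. Qed.
Let Q1E : Q1 = be ^+ 0 * (q3 (b * x1) (b * (y1 + y2)) (a * x2)).[be].
Proof. by rewrite q3E mul1r. Qed.
Let Q2E : Q2 = be ^+ 0 * (q3 (b * x2) (b * (y1 + y2)) (a * x1)).[be].
Proof. by rewrite q3E mul1r. Qed.

Let q3_neq0 c0 c1 c2 : alg c0 -> alg c1 -> alg c2 ->
  (c0 != 0) || (c1 != 0) || (c2 != 0) -> (q3 c0 c1 c2).[be] != 0.
Proof.
move=> A0 A1 A2 c; apply: (transcendental_horner be_trans); first exact: alg_q3.
apply: contraTneq c => q0; rewrite -!orbA !negb_or !negbK.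
have := q3_coef c0 c1 c2; rewrite q0 => cE.
by rewrite -(cE 0%N) -(cE 1%N) -(cE 2%N) !coef0 eqxx.
Qed.

Let w0 : w != 0.
Proof.
have := @q3_neq0 b 0 (- a) alg_b alg_0 (algebraic_opp alg_a).
by rewrite b0 q3E mul0r addr0 mulNr; apply.
Qed.

Let y12 : x2 != 0 -> (y1 != 0) && (y2 != 0).
Proof.
move=> x20; rewrite -negb_or -mulf_eq0 -(inj_eq (mulfI b0)) mulr0 mulrA -xyE.
by rewrite !mulf_eq0 !negb_or a0 x10.
Qed.

Let PQ0 : [/\ P1 != 0, P2 != 0, Q1 != 0 & Q2 != 0].
Proof.
have s0 : x2 = 0 -> a * (x1 + x2) != 0 by move=> ->; rewrite addr0 mulf_neq0.
have be1 : be ^+ 1 != 0 by [].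
rewrite P1E P2E Q1E Q2E; split; apply: mulf_neq0 => //; rewrite ?oner_neq0 //;
  apply: q3_neq0; do ?[exact: alg_M|apply: alg_M => //; exact: alg_D].
- have [/s0 -> //|/y12/andP[_ y20]] := eqVneq x2 0; first by rewrite orbT.
  by rewrite (mulf_neq0 b0 y20).
- have [/s0 -> //|/y12/andP[y10 _]] := eqVneq x2 0; first by rewrite orbT.
  by rewrite (mulf_neq0 b0 y10).
- by rewrite mulf_neq0.
- by rewrite (mulf_neq0 a0 x10) !orbT.
Qed.

Lemma fps_dilC (c : k) : fps_dil rho (fpsC c) = fpsC c.
Proof. by rewrite -poly_fpsC fps_dil_poly poly_dilC. Qed.

Lemma fps_dilX : fps_dil rho (fpsX k) = fpsC rho * fpsX k.
Proof. by rewrite -poly_fpsX fps_dil_poly poly_dilX -mul_polyC rmorphM /= poly_fpsC. Qed.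

(** The expansion at s = 0 of c s / ((s - p) (s - q)), as a power series; its
coefficient of degree 1 shows that it is not constant. *)
Let branch (c p q : k) : c != 0 -> p != 0 -> q != 0 -> exists f : fps k,
  [/\ fps_coef f 0 = 0, fps_rational f, euler f != 0
    & f * poly_fps (('X - p%:P) * ('X - q%:P)) = poly_fps (c *: 'X)].
Proof.
move=> c0 p0 q0; have [g gE] := fps_inv_XsubC p0; have [h hE] := fps_inv_XsubC q0.
pose f := fpsX k * (fpsC c * g * h).
have fE : f * poly_fps (('X - p%:P) * ('X - q%:P)) = poly_fps (c *: 'X).
  rewrite -mul_polyC !rmorphM /= poly_fpsC poly_fpsX.
  transitivity (fpsC c * fpsX k * (g * poly_fps ('X - p%:P))
    * (h * poly_fps ('X - q%:P))); first by rewrite /f; ring.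
  by rewrite gE hE !mulr1.
have f0 : fps_coef f 0 = 0 by rewrite fps_coefXM.
clearbody f.
exists f; split=> //.
  exists (c *: 'X), (('X - p%:P) * ('X - q%:P)); split=> //.
  by rewrite mulf_neq0 ?polyXsubC_eq0.
apply: contraNneq c0 => f'0.
have f1 : fps_coef f 1 = 0.
  by rewrite -[fps_coef f 1]mulr1n -coef_euler f'0.
have := congr1 (fun h => fps_coef h 1) fE.
rewrite fps_coefM big_ord_recl big_ord1 f0 f1 !mul0r addr0.
by rewrite coef_poly_fps coefZ coefX mulr1 => <-.
Qed.

Local Notation C := (@fpsC k).

Let cancelX (g : fps k) (p : k) (N D : {poly k}) :
  g * poly_fps (('X - p%:P) * D) = poly_fps (('X - p%:P) * N) ->
  g * poly_fps D = poly_fps N.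
Proof.
move=> E; have X0 : poly_fps ('X - p%:P) != 0.
  by rewrite poly_fps_eq0 polyXsubC_eq0.
by apply: (mulfI X0); rewrite mulrCA -!rmorphM.
Qed.

Let poly_fps_quad (p q : k) : poly_fps (('X - p%:P) * ('X - q%:P)) =
  fpsX k ^+ 2 - (C p + C q) * fpsX k + C p * C q.
Proof. by rewrite rmorphM !rmorphB /= !poly_fpsC poly_fpsX; ring. Qed.

(** The parametrization of the curve, together with a pole z of
g = x(s) (y(rho s) - y(s)) whose order exceeds that of g at all other points of its
orbit. Explicitly

   g = c s^2 (s^2 - P1 P2) / (rho^2 (s - P1) (s - P2) (s - Q1) (s - Q2)
                                (s - Q1 / rho) (s - Q2 / rho)),

so the matter is which of these six points coincide or share an orbit; the zeros
of s^2 - P1 P2 only interfere when P1 = P2. *)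
Theorem kernel_uniformization : exists (x y : fps k) (m : nat) (z : k),
  let g := x * (fps_dil rho y - y) in
  [/\ [/\ fps_coef x 0 = 0, fps_rational x & euler x != 0],
      [/\ fps_coef y 0 = 0, fps_rational y & euler y != 0],
      kernel (C a) (C b) (C be) (C x1) (C x2) (C y1) (C y2) x y = 0,
      kernel (C a) (C b) (C be) (C x1) (C x2) (C y1) (C y2) x (fps_dil rho y) = 0
    & [/\ z != 0, fps_rational g, fps_pole_eq m.+1 z g,
          forall i, fps_pole_le m (rho ^+ i.+1 * z) g
        & forall i, fps_pole_le m (rho ^- i.+1 * z) g]].
Proof.
have [P10 P20 Q10 Q20] := PQ0.
have [x [x_0 x_rat x'0 xE]] := branch (mulf_neq0 (expf_neq0 2 w0) (invr_neq0 b0)) P10 P20.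
have [y [y_0 y_rat y'0 yE]] :=
  branch (mulf_neq0 (expf_neq0 2 w0) (invr_neq0 (mulf_neq0 a0 be0))) Q10 Q20.
set c1 := w ^+ 2 / b in xE; set c2 := w ^+ 2 / (a * be) in yE.
pose s := fpsX k.
have W0 : C w ^+ 2 * s != 0.
  rewrite mulf_neq0 ?expf_neq0 //.
    by rewrite fpsC_eq0.
  by rewrite /s -poly_fpsX poly_fps_eq0 polyX_eq0.
have wC : C w = C b - C a * C be ^+ 2 by rewrite /w rmorphB rmorphM rmorphXn.
have xU : x * (C b * s ^+ 2 - C b * (C P1 + C P2) * s + C a * C be ^+ 2 * (C Q1 * C Q2))
    = C w ^+ 2 * s.
  have -> : C a * C be ^+ 2 * (C Q1 * C Q2) = C b * (C P1 * C P2).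
    by rewrite -!rmorphXn -!rmorphM ptPM.
  transitivity (C b * (x * poly_fps (('X - P1%:P) * ('X - P2%:P)))).
    by rewrite poly_fps_quad -/s; ring.
  rewrite xE -mul_polyC rmorphM /= poly_fpsC poly_fpsX -/s mulrA -rmorphM /c1.
  by rewrite mulrCA divff // mulr1 rmorphXn.
have yV0 : y * (s ^+ 2 - (C Q1 + C Q2) * s + C Q1 * C Q2) = C c2 * s.
  transitivity (y * poly_fps (('X - Q1%:P) * ('X - Q2%:P))).
    by rewrite poly_fps_quad -/s; ring.
  by rewrite yE -mul_polyC rmorphM /= poly_fpsC poly_fpsX.
have c2E : C a * C be * C c2 = C w ^+ 2.
  by rewrite -!rmorphM /c2 mulrCA divff ?mulr1 ?rmorphXn ?mulf_neq0.
have yV : y * (C a * C be * (s ^+ 2 - (C Q1 + C Q2) * s + C Q1 * C Q2)) = C w ^+ 2 * s.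
  by rewrite mulrCA yV0 mulrA c2E.
have bC : C b = C rho * (C a * C be ^+ 2) by rewrite -rmorphXn -!rmorphM rho_fac.
have dil_quad p q : fps_dil rho (s ^+ 2 - (C p + C q) * s + C p * C q) =
    (C rho * s) ^+ 2 - (C p + C q) * (C rho * s) + C p * C q.
  rewrite !(rmorphM (fps_dil rho), rmorphD (fps_dil rho), rmorphN (fps_dil rho)).
  by rewrite /= !fps_dilC fps_dilX.
have H : fps_dil rho y * ((C rho * s) ^+ 2 - (C Q1 + C Q2) * (C rho * s)
    + C Q1 * C Q2) = C c2 * (C rho * s).
  by rewrite -dil_quad -[LHS]rmorphM yV0 [LHS]rmorphM /= fps_dilC fps_dilX.
have dyV : fps_dil rho y * (C b ^+ 2 * s ^+ 2 - C a * C b * C be ^+ 2 * (C Q1 + C Q2) * s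
      + C a ^+ 2 * C be ^+ 4 * (C Q1 * C Q2)) = C b * C be * C w ^+ 2 * s.
  transitivity (C a ^+ 2 * C be ^+ 4 * (fps_dil rho y * ((C rho * s) ^+ 2
      - (C Q1 + C Q2) * (C rho * s) + C Q1 * C Q2))).
    rewrite bC; move: (C rho) (C a) (C be) (C Q1) (C Q2) (fps_dil rho y) => r a' b' q1 q2 d.
    by ring.
  rewrite H -c2E bC; move: (C rho) (C a) (C be) (C c2) => r a' b' c'; ring.
have lregU u v : u * v = C w ^+ 2 * s -> GRing.lreg v.
  move=> E; apply: mulfI; apply: contraNneq W0 => v0; by rewrite -E v0 mulr0.
have kxy : kernel (C a) (C b) (C be) (C x1) (C x2) (C y1) (C y2) x y = 0.
  apply: (kernel_vanishes (s := s));
    rewrite -?(ptP_morph (@fpsC k)) -?(ptQ_morph (@fpsC k)) -?wC //.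
    exact: lregU xU.
  exact: lregU yV.
have kxdy : kernel (C a) (C b) (C be) (C x1) (C x2) (C y1) (C y2) x (fps_dil rho y) = 0.
  apply: (kernel_vanishes_dil (s := s));
    rewrite -?(ptP_morph (@fpsC k)) -?(ptQ_morph (@fpsC k)) -?wC //.
    exact: lregU xU.
  have bbe0 : C b * C be != 0 by rewrite mulf_neq0 ?fpsC_eq0.
  apply: mulfI; apply: contraNneq (mulf_neq0 bbe0 W0) => v0.
  by rewrite mulrA -dyV v0 mulr0.
have P12 : P1 * P2 = rho * (Q1 / rho) * (Q2 / rho).
  have gen (q1 q2 : k) : a * be ^+ 2 * (q1 * q2) = b * (rho * (q1 / rho) * (q2 / rho)).
    rewrite -[in RHS]rho_fac; move: (rho) rho0 => r r0; field.
    by rewrite r0.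
  by apply: (mulfI b0); rewrite ptPM.
exists x, y.
have gE : x * (fps_dil rho y - y) * poly_fps (rho ^+ 2 *:
    \prod_(r <- [:: P1; P2; Q1; Q2; Q1 / rho; Q2 / rho]) ('X - r%:P)) =
    poly_fps (c1 * c2 * (1 - rho) * rho *: ('X^2 * ('X^2 - (P1 * P2)%:P))).
  have dQ (q : k) : C q = C rho * C (q / rho) by rewrite -rmorphM mulrC mulfVK.
  rewrite -!mul_polyC !big_cons big_nil mulr1.
  rewrite [_ * ('X - (Q2 / rho)%:P)]mulrC.
  transitivity (C rho ^+ 2 * (x * poly_fps (('X - P1%:P) * ('X - P2%:P))) *
     (fps_dil rho y - y) * poly_fps (('X - Q1%:P) * ('X - Q2%:P)) *
     poly_fps (('X - (Q1 / rho)%:P) * ('X - (Q2 / rho)%:P))).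
    rewrite !(rmorphM (@poly_fps k)) /= poly_fpsC rmorphXn; ring.
  rewrite xE !poly_fps_quad -/s.
  set e1 := C (Q1 / rho); set e2 := C (Q2 / rho).
  set Dy := s ^+ 2 - (C Q1 + C Q2) * s + C Q1 * C Q2.
  set De := s ^+ 2 - (e1 + e2) * s + e1 * e2.
  have dyD : fps_dil rho y * (C rho ^+ 2 * De) = C c2 * (C rho * s).
    by rewrite -H (dQ Q1) (dQ Q2) -/e1 -/e2 /De; congr (_ * _); ring.
  transitivity (C c1 * s * ((fps_dil rho y * (C rho ^+ 2 * De)) * Dy
      - (y * Dy) * (C rho ^+ 2 * De))).
    have -> : poly_fps (c1 *: 'X) = C c1 * s.
      by rewrite -mul_polyC rmorphM /= poly_fpsC poly_fpsX.
    by ring.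
  rewrite dyD yV0 P12 /Dy (dQ Q1) (dQ Q2) -/e1 -/e2.
  have -> : poly_fps ((c1 * c2 * (1 - rho) * rho)%:P *
      ('X^2 * ('X^2 - (rho * (Q1 / rho) * (Q2 / rho))%:P))) =
      C c1 * C c2 * (1 - C rho) * C rho * (s ^+ 2 * (s ^+ 2 - C rho * e1 * e2)).
    rewrite /e1 /e2.
    move: (Q1 / rho) (Q2 / rho) (c1) (c2) (rho) => q1 q2 d1 d2 r.
    rewrite !(rmorphM (@poly_fps k), rmorphB (@poly_fps k), rmorphXn (@poly_fps k)) /=.
    rewrite !poly_fpsC poly_fpsX -/s.
    by rewrite !(rmorphM (@fpsC k), rmorphB (@fpsC k), rmorph1 (@fpsC k)).
  by rewrite /De; ring.
set g := x * (fps_dil rho y - y) in gE *.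
set c := c1 * c2 * (1 - rho) * rho in gE.
have c0 : c != 0.
  rewrite /c !mulf_neq0 // ?invr_neq0 ?mulf_neq0 ?expf_neq0 //.
  by rewrite subr_eq0 eq_sym; have := dilation_infinite 0; rewrite expr1.
have r20 : rho ^+ 2 != 0 by rewrite expf_neq0.
have g_rat : fps_rational g.
  eexists; eexists; split; last exact: gE.
  rewrite scaler_eq0 negb_or r20 /=; elim/big_rec: _ => [|r D _ D0].
    by rewrite oner_neq0.
  by rewrite mulf_neq0 // polyXsubC_eq0.
have num_neq0 p : p != 0 -> P1 * P2 != p ^+ 2 ->
    (c *: ('X^2 * ('X^2 - (P1 * P2)%:P))).[p] != 0.
  move=> p0 pP; rewrite hornerZ hornerM hornerD hornerN !hornerXn hornerC.
  apply: mulf_neq0 => //; apply: mulf_neq0; first exact: expf_neq0.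
  by rewrite subr_eq0 eq_sym.
have num1_neq0 p : p != 0 -> (c *: ('X^2 * ('X + p%:P))).[p] != 0.
  move=> p0; rewrite hornerZ hornerM hornerD !hornerXn hornerX hornerC.
  apply: mulf_neq0 => //; apply: mulf_neq0; first exact: expf_neq0.
  rewrite -mulr2n -mulr_natl mulf_neq0 //.
  by have := fmorph_eq0 j 2%:R; rewrite rmorph_nat => ->.
have orbit (m : nat) (z : k) : (forall u p q, p != q ->
    rho ^+ p * u = rho ^+ q * z -> fps_pole_le m u g) ->
    (forall i, fps_pole_le m (rho ^+ i.+1 * z) g) /\
    (forall i, fps_pole_le m (rho ^- i.+1 * z) g).
  move=> H'; split=> i; first by apply: (H' _ 0%N i.+1); rewrite // expr0 mul1r.
  by apply: (H' _ i.+1 0%N); rewrite // expr0 mul1r mulrA divff ?mul1r ?expf_neq0.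
suff [m [z [z0 gz /orbit[]]]] : exists m z, [/\ z != 0, fps_pole_eq m.+1 z g &
    forall u p q, p != q -> rho ^+ p * u = rho ^+ q * z -> fps_pole_le m u g].
  by exists m, z.
have rho_inj := expr_rho_inj rho0 dilation_infinite.
have divrhoE u v p q : rho ^+ p * (u / rho) = rho ^+ q * v ->
    rho ^+ p * u = rho ^+ q.+1 * v.
  by move=> E; rewrite exprSr mulrAC -E -mulrA mulfVK.
(* x2 = 0 means d_(1,1) = 0; then two poles of x are poles of y or of y(rho s). *)
have [x20|x20] := eqVneq x2 0.
  have {}y20 := x2y2 x20.
  have OE : Q2 = P2 by rewrite /ptQ /ptP x20 y20; ring.
  have Q1E' : Q1 = rho * P1.
    have -> : P1 = a * be ^+ 2 * (x1 + y1 * be).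
      by rewrite /ptP x20 y20; ring.
    by rewrite mulrA rho_fac /ptQ x20 y20; ring.
  have Q1rho : Q1 / rho = P1 by rewrite Q1E' mulrC mulKf.
  rewrite Q1rho Q1E' OE in gE.
  have rho1 (p : k) : p != 0 -> rho * p != p.
    move=> p0; rewrite -[X in _ != X]mul1r (inj_eq (mulIf p0)).
    by have := dilation_infinite 0; rewrite expr1.
  have rho1' (p : k) : p != 0 -> p / rho != p.
    move=> p0; rewrite -(inj_eq (mulfI rho0)) mulrCA divff // mulr1 eq_sym.
    exact: rho1.
  have [y1_0|y1_0] := eqVneq y1 0.
    (* P1 = P2 = Q2 = Q1 / rho is a double pole of x and a pole of y and of
    y(rho s); one factor cancels with s^2 - P1 P2, which leaves a triple pole. *)
    have P12E : P2 = P1 by rewrite /ptP y1_0 y20.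
    rewrite P12E in gE.
    have gE1 : g * poly_fps (rho ^+ 2 *: \prod_(r <- [:: P1; P1; P1; rho * P1; P1 / rho])
        ('X - r%:P)) = poly_fps (c *: ('X^2 * ('X + P1%:P))).
      apply: (cancelX (p := P1)).
      transitivity (g * poly_fps (rho ^+ 2 *:
         \prod_(r <- [:: P1; P1; rho * P1; P1; P1; P1 / rho]) ('X - r%:P))).
        by rewrite -scalerAr !big_cons big_nil; congr (_ * poly_fps (_ *: _)); ring.
      rewrite gE; congr poly_fps; rewrite -scalerAr; congr (_ *: _).
      by rewrite rmorphM /=; ring.
    have cnt := count_mem_aaabc P1 (rho * P1) (P1 / rho).
    exists 2%N, P1; split=> // [|u p q pq E].
      have := fps_pole_eq_prod (z := P1) r20 gE1.
      rewrite cnt eqxx (negPf (rho1 _ P10)) (negPf (rho1' _ P10)); apply.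
      exact: num1_neq0.
    apply: fps_pole_leW (fps_pole_le_prod u r20 gE1).
    rewrite cnt; have [uE|_] := eqVneq P1 u.
      by move: E pq; rewrite -uE => /(mulIf P10)/rho_inj ->; rewrite eqxx.
    by case: (rho * P1 == u); case: (P1 / rho == u).
  (* P2 = Q2 is a pole of x and of y, hence a double pole of g. It has order 1
  in be and P1 has order 2, so P1 and Q1 = rho P1 are not in its orbit, which meets
  the poles of g only in P2 and, with order 1, in P2 / rho. *)
  have OE1 : P2 = be ^+ 1 * (q3 (b * y1) (a * x1) 0).[be].
    by rewrite q3E /ptP x20 y20; ring.
  have P1E1 : P1 = be ^+ 2 * (q3 (a * x1) (a * y1) 0).[be].
    by rewrite q3E /ptP x20 y20; ring.
  have algO : forall i, alg (q3 (b * y1) (a * x1) 0)`_i.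
    by apply: alg_q3 => //; apply: alg_M.
  have algP : forall i, alg (q3 (a * x1) (a * y1) 0)`_i.
    by apply: alg_q3 => //; apply: alg_M.
  have orb p q : rho ^+ p * P1 = rho ^+ q * P2 -> False.
    by move=> E; apply: even_neq_oddS (orbit_order algP algO _ _ P1E1 OE1 E);
      rewrite q3_coef mulf_neq0.
  have orb1 u p q : rho ^+ p * u = rho ^+ q * P2 -> P1 != u.
    by move=> E; apply: contra_eqN E => /eqP <-; apply/eqP => /orb.
  have orb2 u p q : rho ^+ p * u = rho ^+ q * P2 -> rho * P1 != u.
    move=> E; apply: contra_eqN E => /eqP <-; apply/eqP.
    by rewrite mulrA -exprSr => /orb.
  have cnt := count_mem_abcbad P1 P2 (rho * P1) (P2 / rho).
  exists 1%N, P2; split=> // [|u p q pq E].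
    have := fps_pole_eq_prod (z := P2) r20 gE.
    rewrite cnt eqxx (negPf (rho1' _ P20)) (negPf (orb1 P2 0%N 0%N _)) //.
    rewrite (negPf (orb2 P2 0%N 0%N _)) //; apply; apply: num_neq0 => //.
    by rewrite expr2 (inj_eq (mulIf P20)) (orb1 P2 0%N 0%N).
  apply: fps_pole_leW (fps_pole_le_prod u r20 gE).
  rewrite cnt (negPf (orb1 _ _ _ E)) (negPf (orb2 _ _ _ E)).
  have [uE|_] := eqVneq P2 u; last by case: (P2 / rho == u).
  by move: E pq; rewrite -uE => /(mulIf P20)/rho_inj ->; rewrite eqxx.
(* The P_i have order 1 in be and the Q_i have order 0: the orbit of P1 contains
neither the Q_i nor the Q_i / rho, and contains P2 only if P2 = P1. *)
have /andP[y10 y20] := y12 x20.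
have algP1 : forall i, alg (q3 (b * y2) (a * (x1 + x2)) (a * y1))`_i.
  by apply: alg_q3; apply: alg_M => //; apply: alg_D.
have algP2 : forall i, alg (q3 (b * y1) (a * (x1 + x2)) (a * y2))`_i.
  by apply: alg_q3; apply: alg_M => //; apply: alg_D.
have algQ1 : forall i, alg (q3 (b * x1) (b * (y1 + y2)) (a * x2))`_i.
  by apply: alg_q3; apply: alg_M => //; apply: alg_D.
have algQ2 : forall i, alg (q3 (b * x2) (b * (y1 + y2)) (a * x1))`_i.
  by apply: alg_q3; apply: alg_M => //; apply: alg_D.
have orbPP p q : rho ^+ p * P2 = rho ^+ q * P1 -> p = q.
  by move=> E; apply: odd_eq_odd (orbit_order algP2 algP1 _ _ P2E P1E E);
    rewrite q3_coef mulf_neq0.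
have orbQ1 p q : rho ^+ p * Q1 = rho ^+ q * P1 -> False.
  by move=> E; apply: even_neq_odd (orbit_order algQ1 algP1 _ _ Q1E P1E E);
    rewrite q3_coef mulf_neq0.
have orbQ2 p q : rho ^+ p * Q2 = rho ^+ q * P1 -> False.
  by move=> E; apply: even_neq_odd (orbit_order algQ2 algP1 _ _ Q2E P1E E);
    rewrite q3_coef mulf_neq0.
have notin u p q : rho ^+ p * u = rho ^+ q * P1 ->
    u \notin [:: Q1; Q2; Q1 / rho; Q2 / rho].
  move=> E; apply/negP; rewrite !inE.
  case/or4P=> /eqP uE; rewrite uE in E;
    [exact: orbQ1 E|exact: orbQ2 E|exact: orbQ1 (divrhoE _ _ _ _ E)
    |exact: orbQ2 (divrhoE _ _ _ _ E)].
exists 0%N, P1.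
have P1notin : P1 \notin [:: Q1; Q2; Q1 / rho; Q2 / rho] by apply: (notin _ 0%N 0%N).
have other u p q : p != q -> rho ^+ p * u = rho ^+ q * P1 -> fps_pole_le 0 u g.
  move=> pq E; have := fps_pole_le_prod u r20 gE.
  suff -> : count_mem u [:: P1; P2; Q1; Q2; Q1 / rho; Q2 / rho] = 0%N by [].
  apply/count_memPn; rewrite in_cons negb_or in_cons negb_or (notin _ _ _ E) andbT.
  apply/andP; split; apply: contra_neqN pq => /eqP uE; move: E; rewrite uE.
    by move/(mulIf P10)/rho_inj.
  by move/orbPP.
split=> //; have [P12E|P12E] := eqVneq P1 P2; last first.
  have := fps_pole_eq_prod (z := P1) r20 gE.
  have -> : count_mem P1 [:: P1; P2; Q1; Q2; Q1 / rho; Q2 / rho] = 1%N.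
    by apply: count_mem_head; rewrite in_cons negb_or P12E.
  by apply; apply: num_neq0 => //; rewrite expr2 (inj_eq (mulfI P10)) eq_sym.
(* If P1 = P2, one of the two factors s - P1 cancels with s^2 - P1 P2. *)
have gE1 : g * poly_fps (rho ^+ 2 *: \prod_(r <- [:: P1; Q1; Q2; Q1 / rho; Q2 / rho])
    ('X - r%:P)) = poly_fps (c *: ('X^2 * ('X + P1%:P))).
  apply: (cancelX (p := P1)); move: gE; rewrite -P12E => gE.
  transitivity (g * poly_fps (rho ^+ 2 *:
     \prod_(r <- [:: P1; P1; Q1; Q2; Q1 / rho; Q2 / rho]) ('X - r%:P))).
    by rewrite [in RHS]big_cons -scalerAr.
  rewrite gE; congr poly_fps; rewrite -scalerAr; congr (_ *: _).
  by rewrite rmorphM /=; ring.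
have := fps_pole_eq_prod (z := P1) r20 gE1.
have -> : count_mem P1 [:: P1; Q1; Q2; Q1 / rho; Q2 / rho] = 1%N.
  exact: count_mem_head.
by apply; apply: num1_neq0.
Qed.

End Uniformization.

(** * The functional equation *)

Section WalkRecurrence.
Context (d : step -> rat).
Hypothesis wd : weights d.

Lemma endpoint_rcons w s : endpoint (rcons w s) = endpoint w + step_vec s.
Proof. by rewrite /endpoint -cats1 big_cat big_seq1. Qed.

Lemma quarter_plane_walkP k (w : k.-tuple step) :
  reflect (forall r, (r <= k)%N ->
    0 <= (endpoint (take r w)).1 /\ 0 <= (endpoint (take r w)).2)
  (quarter_plane_walk w).
Proof.
apply: (iffP forallP) => H r; last by apply/andP/H; rewrite -ltnS.
by rewrite -ltnS => rk; apply/andP/(H (Ordinal rk)).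
Qed.

Lemma quarter_plane_walk_rcons k (w : k.-tuple step) s :
  quarter_plane_walk [tuple of rcons w s] =
  [&& quarter_plane_walk w, 0 <= (endpoint w + step_vec s).1
    & 0 <= (endpoint w + step_vec s).2].
Proof.
apply/quarter_plane_walkP/and3P => [H|[/quarter_plane_walkP H e1 e2] r].
  have := H k.+1 (leqnn _); rewrite take_oversize ?size_rcons ?size_tuple //.
  rewrite endpoint_rcons => -[e1 e2]; split=> //; apply/quarter_plane_walkP => r rk.
  have := H r (leqW rk); rewrite /= -cats1 takel_cat ?size_tuple //.
rewrite leq_eqVlt ltnS => /predU1P[->|rk].
  by rewrite take_oversize ?size_rcons ?size_tuple // endpoint_rcons.
by rewrite /= -cats1 takel_cat ?size_tuple //; apply: H.
Qed.

Lemma walk_coef0 i j : walk_coef d i j 0 = ((i == 0%N) && (j == 0%N))%:R.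
Proof.
rewrite /walk_coef; have -> : (i == 0%N) && (j == 0%N) =
    (quarter_plane_walk [tuple] && (endpoint [::] == (i%:Z, j%:Z))).
  rewrite /endpoint big_nil xpair_eqE ![0 == Posz _]eq_sym.
  have -> // : quarter_plane_walk [tuple].
  by apply/quarter_plane_walkP => r _; rewrite /endpoint big_nil.
rewrite (eq_bigl (fun w => (w == [tuple]) &&
    (quarter_plane_walk [tuple] && (endpoint [::] == (i%:Z, j%:Z))))); last first.
  by move=> w; rewrite (tuple0 w) eqxx.
case: (_ && _); last by rewrite big_pred0 // => w; rewrite andbF.
rewrite (big_pred1 [tuple]) => [|w]; last by rewrite andbT.
by rewrite /walk_weight big_nil.
Qed.

(** The coefficient at the vertex (i, j) - step_vec s that precedes the step s,
and 0 if this vertex is outside the quarter plane. *)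
Definition before_coef (s : step) i j k : rat :=
  if (s.1 <= i.+1)%N && (s.2 <= j.+1)%N
  then walk_coef d (i.+1 - s.1) (j.+1 - s.2) k else 0.

(** A walk with k + 1 steps is a walk with k steps followed by its last step. *)
Lemma walk_coefS i j k :
  walk_coef d i j k.+1 = \sum_s d s * before_coef s i j k.
Proof.
pose h (p : step * k.-tuple step) : k.+1.-tuple step := [tuple of rcons p.2 p.1].
pose h' (w : k.+1.-tuple step) : step * k.-tuple step :=
  (last (thead w) (behead w), [tuple of belast (thead w) (behead w)]).
have h'K : cancel h' h.
  move=> w; apply: val_inj => /=; rewrite -lastI.
  by rewrite [in RHS](tuple_eta w).
have hK : cancel h h'.
  move=> [s w]; rewrite /h /h' /=.
  have E : thead [tuple of rcons w s] :: behead (rcons w s) = rcons w s.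
    by have := tuple_eta [tuple of rcons w s] => /(congr1 val) /= <-.
  move: E; rewrite lastI => /rcons_inj[E1 E2].
  by congr (_, _); last apply: val_inj.
rewrite /walk_coef (reindex h) /=; last by exists h' => ? _.
rewrite (eq_bigl (fun p : step * k.-tuple step =>
  quarter_plane_walk p.2 && (endpoint p.2 + step_vec p.1 == (i%:Z, j%:Z)))); last first.
  move=> [s w]; rewrite [LHS]andbC.
  rewrite [(_, w).2]/= [(s, _).1]/= (endpoint_rcons w s) quarter_plane_walk_rcons.
  by case: eqP => [->|_]; rewrite ?andbF ?andbT.
rewrite (eq_bigr (fun p : step * k.-tuple step => d p.1 * walk_weight d p.2)); last first.
  by move=> [s w] _; rewrite /walk_weight /= -cats1 big_cat big_seq1 mulrC.
rewrite big_mkcond -(pair_bigA _ (fun s (w : k.-tuple step) =>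
  if quarter_plane_walk w && (endpoint w + step_vec s == (i%:Z, j%:Z))
  then d s * walk_weight d w else 0)) /=.
apply: eq_bigr => s _; rewrite -big_mkcond /= -big_distrr /=; congr (_ * _).
rewrite /before_coef /walk_coef; case: ifP => [/andP[si sj]|out].
  apply: eq_bigl => w; congr (_ && _); case: (endpoint w) => e1 e2.
  have -> : (e1, e2) + step_vec s = (e1 + (s.1%:Z - 1), e2 + (s.2%:Z - 1)) by [].
  rewrite !xpair_eqE; move: (nat_of_ord s.1) (nat_of_ord s.2) si sj => m n mi nj.
  by congr (_ && _); apply/eqP/eqP; lia.
rewrite big_pred0 // => w; apply: contraFF out.
case/andP=> /quarter_plane_walkP/(_ k (leqnn _)).
rewrite take_oversize ?size_tuple //; case: (endpoint w) => e1 e2 /= [e10 e20].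
have -> : (e1, e2) + step_vec s = (e1 + (s.1%:Z - 1), e2 + (s.2%:Z - 1)) by [].
by rewrite xpair_eqE; move: (nat_of_ord s.1) (nat_of_ord s.2) => m n; lia.
Qed.

(** The coefficients of t^k are at most 1 since the weights sum to 1: the series
in t is dominated by the geometric series. *)
Lemma walk_coef_bound i j k : 0 <= walk_coef d i j k <= 1.
Proof.
elim: k i j => [|k IHk] i j; first by rewrite walk_coef0 ler0n lern1 leq_b1.
have before s : 0 <= before_coef s i j k <= 1.
  by rewrite /before_coef; case: ifP; rewrite ?IHk ?lexx ?ler01.
case: wd => d01 <-; rewrite walk_coefS; apply/andP; split.
  apply: sumr_ge0 => s _; apply: mulr_ge0; first by case/andP: (d01 s).
  by case/andP: (before s).
apply: ler_sum => s _; rewrite -[leRHS]mulr1 ler_wpM2l //.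
  by case/andP: (d01 s).
by case/andP: (before s).
Qed.

End WalkRecurrence.

Section WalkSeries.
Context (R : realType) (d : step -> rat) (t : R).
Hypotheses (wd : weights d) (t01 : 0 < t < 1).

Let q i j := fps_coef (fps_coef (walk_series d t) i) j.
Local Notation tends u l := (cvg_to (nbhs (fmap u (nbhs eventually))) (nbhs l)).

Let u i j : nat -> R := fun k => ratr (walk_coef d i j k) * t ^+ k.

Let walk_series_cvg i j : tends (series (u i j)) (q i j).
Proof.
have [t0 t1] := andP t01.
have coef01 k : 0 <= (ratr (walk_coef d i j k) : R) <= 1.
  have /andP[c0] := walk_coef_bound wd i j k.
  by rewrite ler0q c0 -(ler_rat R) rmorph1.
apply: (@series_le_cvg _ (u i j) (fun k => 1 * t ^+ k)) => [k|k|k|].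
- have /andP[c0 _] := coef01 k.
  by apply: mulr_ge0 => //; rewrite exprn_ge0 // ltW.
- by rewrite mul1r exprn_ge0 ?ltW.
- have /andP[_ c1] := coef01 k.
  by apply: ler_wpM2r => //; rewrite exprn_ge0 // ltW.
- by apply: (is_cvg_geometric_series (a := 1)); rewrite ger0_norm // ltW.
Qed.

Definition before (s : step) i j : R :=
  if (s.1 <= i.+1)%N && (s.2 <= j.+1)%N then q (i.+1 - s.1) (j.+1 - s.2) else 0.

(** The recurrence on the number of steps passes to the limit in the partial sums
of the series in t. *)
Lemma walk_series_rec i j :
  q i j = ((i == 0%N) && (j == 0%N))%:R + t * \sum_s ratr (d s) * before s i j.
Proof.
pose v s k := ratr (before_coef d s i j k) * t ^+ k : R.
have v_cvg s : tends (series (v s)) (before s i j).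
  rewrite /before /v /before_coef; case: ifP => _; first exact: walk_series_cvg.
  rewrite (_ : series _ = fun=> 0); first exact: cvg_cst.
  apply/funext => n; rewrite /series /= big1 // => k _.
  by rewrite rmorph0 mul0r.
pose w n := ((i == 0%N) && (j == 0%N))%:R + t * \sum_s ratr (d s) * series (v s) n.
have w_cvg : tends w (((i == 0%N) && (j == 0%N))%:R +
    t * \sum_s ratr (d s) * before s i j).
  apply: cvgD; first exact: cvg_cst.
  apply: cvgM; first exact: cvg_cst.
  elim: (index_enum _) => [|s r IHr].
    rewrite big_nil (_ : (fun n => _) = fun=> 0); first exact: cvg_cst.
    by apply/funext => n; rewrite big_nil.
  rewrite big_cons (_ : (fun n => _) = fun n => ratr (d s) * series (v s) n +
      \sum_(s <- r) ratr (d s) * series (v s) n); last first.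
    by apply/funext => n; rewrite big_cons.
  by apply: cvgD => //; apply: cvgM; [exact: cvg_cst | exact: v_cvg].
have wE : w = fun n => series (u i j) n.+1.
  apply/funext => n; rewrite /w /series /= big_nat_recl //.
  rewrite {1}/u walk_coef0 ratr_nat expr0 mulr1; congr (_ + _).
  rewrite mulr_sumr (eq_bigr (fun s => \sum_(0 <= k < n) t * (ratr (d s) * v s k)));
    last by move=> s _; rewrite -[RHS]mulr_sumr -mulr_sumr.
  rewrite exchange_big /=; apply: eq_bigr => k _.
  rewrite /u walk_coefS rmorph_sum mulr_suml; apply: eq_bigr => s _.
  by rewrite rmorphM /v exprS /=; ring.
have := @walk_series_cvg i j; rewrite -cvg_shiftS => u_cvg.
have w_cvg' : tends w (q i j) by rewrite wE; exact: u_cvg.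
exact: cvg_unique w_cvg' w_cvg.
Qed.

End WalkSeries.

(** Multiplication by the variables shifts the coefficients, so both sides are
compared at X^i Y^j by the recurrence. The terms Qx and Qy supply the values of the
shifted coefficients on the two axes. The coefficient function is abstract: only its
values on products with X, Y and constants matter. *)
Lemma functional_equation_coef (R S : comNzRingType) (X Y : S) (c : R -> S)
    (co : S -> nat -> nat -> R) (q : nat -> nat -> R) (Q Qx Qy : S)
    (t a b e12 e22 e21 e11 : R) :
  (forall f g i j, co (f + g) i j = co f i j + co g i j) ->
  (forall f i j, co (- f) i j = - co f i j) ->
  (forall r f i j, co (c r * f) i j = r * co f i j) ->
  (forall f i j, co (X * f) i j = if i is i'.+1 then co f i' j else 0) ->
  (forall f i j, co (Y * f) i j = if j is j'.+1 then co f i j' else 0) ->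
  (forall i j, co 1 i j = ((i == 0%N) && (j == 0%N))%:R) ->
  (forall i j, co Q i j = q i j) ->
  (forall i j, co Qx i j = if j is 0 then q i 0%N else 0) ->
  (forall i j, co Qy i j = if i is 0 then q 0%N j else 0) ->
  (forall i j, q i j = ((i == 0%N) && (j == 0%N))%:R
    + t * (a * (if j is j'.+1 then q i.+1 j' else 0)
       + e12 * (if j is j'.+1 then q i j' else 0)
       + e22 * (if i is i'.+1 then if j is j'.+1 then q i' j' else 0 else 0)
       + e21 * (if i is i'.+1 then q i' j else 0)
       + e11 * q i j
       + b * (if i is i'.+1 then q i' j.+1 else 0))) ->
  forall i j,
  co (X * (Y * Q) - c t * (c a * (Y * (Y * Q)) + c e12 * (X * (Y * (Y * Q)))
    + c e22 * (X * (X * (Y * (Y * Q)))) + c e21 * (X * (X * (Y * Q)))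
    + c e11 * (X * (Y * Q)) + c b * (X * (X * Q)))) i j
  = co (X * (Y * 1) - c t * (c b * (X * (X * Qx)) + c a * (Y * (Y * Qy)))) i j.
Proof.
move=> coD coN coc coX coY co1 coQ coQx coQy rec i j.
rewrite !(coD, coN, coc); case: i j => [|[|i]] [|[|j]];
  rewrite !(coX, coY) /= ?(coX, coY) /= ?(coX, coY) /= ?(coX, coY) /=;
  rewrite ?(coQ, coQx, coQy, co1) /=.
all: try by ring.
all: rewrite {1}rec /=; ring.
Qed.

Section FunctionalEquation.
Context (R : realType) (d : step -> rat) (t : R).
Hypotheses (wd : weights d) (t01 : 0 < t < 1).
Hypothesis d_SW : forall s : step, (s.1 + s.2 <= 1)%N -> d s = 0.

Definition step_weight (m n : nat) : R := ratr (d (inord m, inord n)).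
Local Notation e := step_weight.
Local Notation Q := (walk_series d t).
Local Notation q i j := (fps_coef (fps_coef Q i) j).
Local Notation X := (fpsX (fps R)).
Local Notation Y := (fpsC (fpsX R)).
Local Notation c r := (fpsC (fpsC r)).

Lemma walk_series_rec6 i j : q i j = ((i == 0%N) && (j == 0%N))%:R
  + t * (e 0 2 * (if j is j'.+1 then q i.+1 j' else 0)
       + e 1 2 * (if j is j'.+1 then q i j' else 0)
       + e 2 2 * (if i is i'.+1 then if j is j'.+1 then q i' j' else 0 else 0)
       + e 2 1 * (if i is i'.+1 then q i' j else 0)
       + e 1 1 * q i j
       + e 2 0 * (if i is i'.+1 then q i' j.+1 else 0)).
Proof.
rewrite {1}(walk_series_rec wd t01); congr (_ + t * _).
have sumE (F : step -> R) : (forall s : step, (s.1 + s.2 <= 1)%N -> F s = 0) ->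
    \sum_s F s = F (inord 0, inord 2) + F (inord 1, inord 2) + F (inord 2, inord 2)
      + F (inord 2, inord 1) + F (inord 1, inord 1) + F (inord 2, inord 0).
  move=> F0; have -> : \sum_s F s = \sum_(m < 3) \sum_(n < 3) F (m, n).
    by rewrite pair_bigA; apply: eq_bigr => -[].
  have -> : (inord 0 : 'I_3) = ord0 by apply: val_inj; rewrite /= inordK.
  have -> : (inord 1 : 'I_3) = lift ord0 ord0 by apply: val_inj; rewrite /= inordK.
  have -> : (inord 2 : 'I_3) = lift ord0 (lift ord0 ord0).
    by apply: val_inj; rewrite /= inordK.
  rewrite !big_ord_recl !big_ord0 (F0 (ord0, ord0)) // (F0 (ord0, lift ord0 ord0)) //.
  by rewrite (F0 (lift ord0 ord0, ord0)) //; ring.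
rewrite sumE => [|s /d_SW ->]; last by rewrite rmorph0 mul0r.
rewrite /before /= !inordK //.
by case: i j => [|i] [|j]; rewrite /= ?subSS ?subn0.
Qed.

(** The series Q(x, 0), in the variable x. *)
Definition series_x0 : fps R := FPS (fun i => q i 0%N).

Definition embed_x (f : fps R) : fps (fps R) := FPS (fun i => fpsC (fps_coef f i)).

(** The kernel equation K Q = x y - t b x^2 Q(x, 0) - t a y^2 Q(0, y), where
Q(0, y) is fps_coef Q 0 and step_weight is indexed as in the type step: e 0 2 and
e 2 0 are the weights of (-1, 1) and (1, -1). *)
Theorem walk_functional_equation :
  X * (Y * Q) - c t * (c (e 0 2) * (Y * (Y * Q)) + c (e 1 2) * (X * (Y * (Y * Q)))
    + c (e 2 2) * (X * (X * (Y * (Y * Q)))) + c (e 2 1) * (X * (X * (Y * Q)))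
    + c (e 1 1) * (X * (Y * Q)) + c (e 2 0) * (X * (X * Q)))
  = X * (Y * 1) - c t * (c (e 2 0) * (X * (X * embed_x series_x0))
                        + c (e 0 2) * (Y * (Y * fpsC (fps_coef Q 0)))).
Proof.
apply: fpsP => i; apply: fpsP => j.
apply: (functional_equation_coef (c := fun r => c r) (q := fun i j => q i j)
  (co := fun f i j => fps_coef (fps_coef f i) j)) => {i j}.
- by [].
- by [].
- by move=> r f i j; rewrite !fps_coefCM.
- by move=> f i j; rewrite fps_coefXM; case: i.
- by move=> f i j; rewrite fps_coefCM fps_coefXM.
- by move=> [|i] [|j].
- by [].
- by move=> i [|j].
- by move=> [|i] j.
- exact: walk_series_rec6.
Qed.

End FunctionalEquation.

(** * Transfer of algebraic relations by substitution *)

Section RationalSeries.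
Context (k : fieldType).
Implicit Types f g : fps k.

Lemma fps_rationalC c : fps_rational (fpsC c : fps k).
Proof. by exists c%:P, 1; rewrite oner_neq0 rmorph1 mulr1 poly_fpsC. Qed.

Lemma fps_rationalD f g : fps_rational f -> fps_rational g -> fps_rational (f + g).
Proof.
move=> [N [D [D0 fE]]] [N' [D' [D'0 gE]]].
exists (N * D' + N' * D), (D * D'); split; first by rewrite mulf_neq0.
by rewrite !(rmorphM, rmorphD) /= -fE -gE; ring.
Qed.

Lemma fps_rationalM f g : fps_rational f -> fps_rational g -> fps_rational (f * g).
Proof.
move=> [N [D [D0 fE]]] [N' [D' [D'0 gE]]].
exists (N * N'), (D * D'); split; first by rewrite mulf_neq0.
by rewrite !rmorphM /= -fE -gE; ring.
Qed.

Lemma fps_rationalN f : fps_rational f -> fps_rational (- f).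
Proof.
by move=> [N [D [D0 fE]]]; exists (- N), D; rewrite rmorphN mulNr fE.
Qed.

End RationalSeries.

(* In the application Psi is the substitution of a rational function u(s) for one of
the variables x and y, the other one being sent to a constant of k, and D is the
derivation with respect to the former variable. *)
Section Transfer.
Context (k : fieldType) (S : idomainType) (Psi : {rmorphism S -> fps k}).
Hypothesis Psi_inj : injective Psi.
Context (D : S -> S) (u : fps k).
Hypothesis chain_rule : forall f, euler (Psi f) = Psi (D f) * euler u.

(** The fractions that Psi sends to k(s). *)
Definition rational_image (x : {fraction S}) : Prop :=
  exists r, rat_fps r = frac_map Psi_inj x :> {fraction (fps k)}.

Lemma rational_image_tofrac x : fps_rational (Psi x) -> rational_image (tofrac x).
Proof. by move/fps_rationalP => [r rE]; exists r; rewrite frac_map_tofrac. Qed.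

Lemma rational_imageM x y :
  rational_image x -> rational_image y -> rational_image (x * y).
Proof. by move=> [r rE] [s sE]; exists (r * s); rewrite !rmorphM /= rE sE. Qed.

Lemma rational_imageD x y :
  rational_image x -> rational_image y -> rational_image (x + y).
Proof. by move=> [r rE] [s sE]; exists (r + s); rewrite !rmorphD /= rE sE. Qed.

Lemma rational_image_div x y :
  rational_image x -> rational_image y -> rational_image (x / y).
Proof. by move=> [r rE] [s sE]; exists (r / s); rewrite !fmorph_div /= rE sE. Qed.

Lemma rational_image0 : rational_image 0.
Proof. by exists 0; rewrite !rmorph0. Qed.

Lemma rational_image1 : rational_image 1.
Proof. by exists 1; rewrite !rmorph1. Qed.

(** A relation over the rational image is carried by Psi to a relation with
coefficients in k(s) between the series Psi (D^i Q). *)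
Theorem transfer_diff_transcendental (Kset : {fraction S} -> Prop)
    (rho : k) (f : fps k) m z Q (E e T : fps k) :
  (forall x, Kset x -> rational_image x) ->
  (forall n, n.+1%:R != 0 :> k) -> rho != 0 -> (forall n, rho ^+ n.+1 != 1) ->
  z != 0 ->
  let b := fps_dil rho f - f in
  fps_rational b -> fps_pole_eq m.+1 z b ->
  (forall i, fps_pole_le m (rho ^+ i.+1 * z) b) ->
  (forall i, fps_pole_le m (rho ^- i.+1 * z) b) ->
  fps_rational u -> euler u != 0 ->
  fps_rational E -> fps_rational e -> fps_rational T -> E != 0 -> T != 0 ->
  E * Psi Q = T * f + e ->
  ~ diff_algebraic Kset D Q.
Proof.
move=> K_rat char0 rho0 rho_inf z0 b b_rat b_z b_pos b_neg u_rat u'0.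
move=> [N1 [D1 [D10 E1]]] [N2 [D2 [D20 E2]]] [N3 [D3 [D30 E3]]] E0 T0 QE.
move=> [n [P [P0 PK PQ]]].
have nz (p q : {poly k}) (h : fps k) : q != 0 -> h != 0 ->
    h * poly_fps q = poly_fps p -> p != 0.
  by move=> q0 h0 hE; rewrite -poly_fps_eq0 -hE mulf_neq0 // poly_fps_eq0.
apply: (@composite_independent k rho char0 rho0 rho_inf f m z n.+1 u
  (fun i => Psi (iter i D Q)) (N1 * D2 * D3) (N2 * D1 * D3) (N3 * D1 * D2)) => //.
- by rewrite !mulf_neq0 // (nz _ _ _ D10 E0 E1).
- by rewrite !mulf_neq0 // (nz _ _ _ D30 T0 E3).
- rewrite !rmorphM /= -E1 -E2 -E3.
  transitivity (E * Psi Q * poly_fps D1 * poly_fps D2 * poly_fps D3); first by ring.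
  by rewrite QE; ring.
have /choice[r rE] : forall mon, exists r,
    rat_fps r = frac_map Psi_inj (mcoeff mon P) by move=> mon; apply/K_rat/PK.
pose P' := \sum_(mon <- msupp P) r mon *: 'X_[mon].
have P'E : map_mpoly (@rat_fps k) P' = map_mpoly (frac_map Psi_inj) P.
  rewrite rmorph_sum /= {2}[P]mpolyE rmorph_sum /=.
  by apply: eq_bigr => mon _; rewrite !map_mpolyZ !map_mpolyX /= rE.
have mapE (A B : fieldType) (h : {rmorphism A -> B}) (p : {mpoly A[n.+1]}) v :
    mmap h v p = meval v (map_mpoly h p).
  elim/mpolyind: p => [|c mon p _ _ IHp]; first by rewrite !rmorph0.
  by rewrite !rmorphD /= IHp map_mpolyZ map_mpolyX mmapZ mmapX mevalZ mevalX.
exists P'.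
  apply: contraNneq P0 => P'0; apply/eqP/mpolyP => mon; rewrite mcoeff0.
  apply: (fmorph_inj (frac_map Psi_inj)).
  have := congr1 (mcoeff mon) P'E; rewrite P'0 rmorph0 mcoeff0 mcoeff_map_mpoly.
  by move=> <-; rewrite rmorph0.
rewrite mapE P'E -mapE.
transitivity (frac_map Psi_inj (meval (fun i : 'I_n.+1 => tofrac (iter i D Q)) P)).
  rewrite mevalE rmorph_sum /=; apply: eq_bigr => mon _.
  rewrite rmorphM rmorph_prod /=; congr (_ * _); apply: eq_bigr => i _.
  by rewrite rmorphXn /= frac_map_tofrac.
by rewrite PQ rmorph0.
Qed.

End Transfer.

(** * Transcendence of the walk series *)

(** The functional equation under a morphism, in the normal form in which its kernel
is recognized as a polynomial in Phi X and Phi Y. *)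
Lemma map_functional_equation (S T : comNzRingType) (Phi : {rmorphism S -> T})
    (X Y Q Qx Qy t a b e12 e22 e21 e11 : S) :
  X * (Y * Q) - t * (a * (Y * (Y * Q)) + e12 * (X * (Y * (Y * Q)))
    + e22 * (X * (X * (Y * (Y * Q)))) + e21 * (X * (X * (Y * Q)))
    + e11 * (X * (Y * Q)) + b * (X * (X * Q)))
  = X * (Y * 1) - t * (b * (X * (X * Qx)) + a * (Y * (Y * Qy))) ->
  (Phi X * Phi Y - Phi t * (Phi a * Phi Y ^+ 2 + Phi e12 * Phi X * Phi Y ^+ 2
    + Phi e22 * Phi X ^+ 2 * Phi Y ^+ 2 + Phi e21 * Phi X ^+ 2 * Phi Y
    + Phi e11 * Phi X * Phi Y + Phi b * Phi X ^+ 2)) * Phi Q =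
  Phi X * Phi Y - Phi t * (Phi b * Phi X ^+ 2 * Phi Qx + Phi a * Phi Y ^+ 2 * Phi Qy).
Proof.
move=> E; rewrite -!(rmorphXn, rmorphM, rmorphD, rmorphB); congr (Phi _).
transitivity (X * (Y * 1) - t * (b * (X * (X * Qx)) + a * (Y * (Y * Qy)))).
  by rewrite -E; ring.
by ring.
Qed.

Section WalkTranscendence.
Context (R : realType) (d : step -> rat) (t : R).
Context (k : fieldType) (Theta : {rmorphism fps R -> k}).
Hypotheses (wd : weights d) (t01 : 0 < t < 1).
Hypothesis t_trans : ~ algebraicOver (ratr : rat -> R) t.
Hypothesis Theta_inj : injective Theta.
Hypothesis d_SW : forall s : step, (s.1 + s.2 <= 1)%N -> d s = 0.

Let psi : {rmorphism R -> k} := Theta \o (@fpsC R).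
Let jrat : {rmorphism rat -> k} := psi \o (ratr : rat -> R).
Let alg z := algebraicOver jrat z.
Let phi0 : {rmorphism fps R -> fps k} := (@fpsC k) \o Theta.
Let phi1 : {rmorphism R -> fps k} := (@fpsC k) \o psi.

Local Notation e m n := (step_weight R d m n).
Local Notation Q := (walk_series d t).
Local Notation X := (fpsX (fps R)).
Local Notation Y := (fpsC (fpsX R)).
Local Notation c r := (fpsC (fpsC r)).
Local Notation F := (series_x0 d t).
Local Notation G := (fps_coef Q 0).

(* The field k contains, through Theta, the power series in one variable: the one
of the variables x and y that is not substituted, and the real numbers as constant
series. It also contains a slope be and the roots x1, x2, y1, y2 of the quadratic
polynomials formed by the weights. *)
Variables (be x1 x2 y1 y2 : k).
Hypothesis e02 : e 0 2 != 0.
Hypothesis e20 : e 2 0 != 0.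
Local Notation a := (psi (e 0 2)).
Local Notation b := (psi (e 2 0)).
Hypothesis beE : psi t * (a * be ^+ 2 + psi (e 1 1) * be + b) = be.
Hypotheses (xS : psi (e 1 2) = - (a * (x1 + x2))) (xP : psi (e 2 2) = a * x1 * x2).
Hypotheses (yS : psi (e 2 1) = - (b * (y1 + y2))) (yP : psi (e 2 2) = b * y1 * y2).
Hypotheses (x10 : x1 != 0) (x2y2 : x2 = 0 -> y2 = 0).

Let t0 : t != 0. Proof. by case/andP: t01 => /gt_eqF ->. Qed.
Let a0 : a != 0. Proof. by rewrite fmorph_eq0. Qed.
Let b0 : b != 0. Proof. by rewrite fmorph_eq0. Qed.

Let alg_rat r : alg (psi (ratr r)).
Proof. exact: (algebraic_id jrat). Qed.

Let psi_t_trans : ~ alg (psi t).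
Proof.
move=> [p p0 pt]; apply: t_trans; exists p => //.
move: pt; rewrite !rootE (map_poly_comp psi (ratr : rat -> R)) horner_map.
by rewrite fmorph_eq0.
Qed.

Let alg_quadratic u v w z : u != 0 ->
  psi (ratr u) * z ^+ 2 + psi (ratr v) * z + psi (ratr w) = 0 -> alg z.
Proof.
move=> u0 zE; exists (u *: 'X^2 + v *: 'X + w%:P).
  apply/eqP => /(congr1 (fun p : {poly rat} => p`_2)).
  rewrite !coefD !coefZ coefXn coefX coefC /= mulr1 mulr0 !addr0 coef0.
  by move/eqP; rewrite (negPf u0).
rewrite rootE !rmorphD /= !map_polyZ map_polyXn map_polyX map_polyC.
rewrite !hornerD !hornerZ hornerXn hornerX hornerC; apply/eqP; exact: zE.
Qed.

Let alg_x z z' : a * (z + z') = - psi (e 1 2) -> a * z * z' = psi (e 2 2) -> alg z.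
Proof.
move=> S P; apply: (@alg_quadratic (d (inord 0, inord 2))
  (d (inord 1, inord 2)) (d (inord 2, inord 2))).
  by rewrite -(fmorph_eq0 (@ratr R)).
rewrite -[psi (ratr (d (inord 1, inord 2)))]opprK -S -[psi (ratr (d (inord 2, inord 2)))]P.
by rewrite /step_weight; ring.
Qed.

Let alg_y z z' : b * (z + z') = - psi (e 2 1) -> b * z * z' = psi (e 2 2) -> alg z.
Proof.
move=> S P; apply: (@alg_quadratic (d (inord 2, inord 0))
  (d (inord 2, inord 1)) (d (inord 2, inord 2))).
  by rewrite -(fmorph_eq0 (@ratr R)).
rewrite -[psi (ratr (d (inord 2, inord 1)))]opprK -S -[psi (ratr (d (inord 2, inord 2)))]P.
by rewrite /step_weight; ring.
Qed.

Let be0 : be != 0.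
Proof.
apply: contraTneq isT => be0; move: beE; rewrite be0 expr0n !mulr0 !add0r.
by move/eqP; rewrite mulf_eq0 fmorph_eq0 (negPf t0) (negPf b0).
Qed.

(* t is the quotient of be by a polynomial in be with rational coefficients. *)
Let be_trans : ~ alg be.
Proof.
move=> alg_be; apply: psi_t_trans.
have dn0 : a * be ^+ 2 + psi (e 1 1) * be + b != 0.
  by apply: contraNneq be0 => d0; rewrite -beE d0 mulr0.
rewrite (canRL (mulfK dn0) beE); apply: algebraic_div => //.
do !apply: algebraic_add; do ?[exact: alg_rat|apply: algebraic_mul => //].
Qed.

(** The kernel of the functional equation, for values of x and y in k[[s]]. *)
Let Ker (x v : fps k) := x * v - phi1 t * (phi1 (e 0 2) * v ^+ 2
  + phi1 (e 1 2) * x * v ^+ 2 + phi1 (e 2 2) * x ^+ 2 * v ^+ 2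
  + phi1 (e 2 1) * x ^+ 2 * v + phi1 (e 1 1) * x * v + phi1 (e 2 0) * x ^+ 2).

Let image_functional_equation (Phi : {rmorphism fps (fps R) -> fps k}) :
  (forall r, Phi (c r) = phi1 r) ->
  Ker (Phi X) (Phi Y) * Phi Q = Phi X * Phi Y
    - phi1 t * (phi1 (e 2 0) * Phi X ^+ 2 * Phi (embed_x F)
                + phi1 (e 0 2) * Phi Y ^+ 2 * Phi (fpsC G)).
Proof.
move=> Phic; have := map_functional_equation Phi (walk_functional_equation wd t01 d_SW).
by rewrite !Phic.
Qed.

Let Ker_vanishes (x v : fps k) :
  kernel (fpsC a) (fpsC b) (fpsC be) (fpsC x1) (fpsC x2) (fpsC y1) (fpsC y2) x v = 0 ->
  Ker x v = 0.
Proof.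
move=> kxv; have Cbe0 : fpsC be != 0 by rewrite fpsC_eq0.
apply: (mulfI Cbe0); rewrite mulr0 -[RHS](mulr0 (phi1 t)) -kxv.
have E12 : phi1 (e 1 2) = - (fpsC a * (fpsC x1 + fpsC x2)).
  by rewrite -rmorphD -rmorphM -rmorphN -xS.
have E22 : phi1 (e 2 2) = fpsC a * fpsC x1 * fpsC x2.
  by rewrite -!rmorphM -xP.
have E21 : phi1 (e 2 1) = - (fpsC b * (fpsC y1 + fpsC y2)).
  by rewrite -rmorphD -rmorphM -rmorphN -yS.
have Ebe : fpsC be = phi1 t * (fpsC a * fpsC be ^+ 2 + phi1 (e 1 1) * fpsC be + fpsC b).
  have fpsC_quad (p q r s v' : k) : fpsC (p * (q * s ^+ 2 + r * s + v')) =
      fpsC p * (fpsC q * fpsC s ^+ 2 + fpsC r * fpsC s + fpsC v').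
    by rewrite !(rmorphM, rmorphD, rmorphXn).
  by rewrite -fpsC_quad beE.
rewrite /Ker /kernel E12 E22 E21.
transitivity (fpsC be * x * v - phi1 t * fpsC be * (fpsC a * v ^+ 2
  - fpsC a * (fpsC x1 + fpsC x2) * x * v ^+ 2
  + fpsC a * fpsC x1 * fpsC x2 * x ^+ 2 * v ^+ 2
  - fpsC b * (fpsC y1 + fpsC y2) * x ^+ 2 * v + phi1 (e 1 1) * x * v + fpsC b * x ^+ 2)).
  by rewrite -[phi1 (e 0 2)]/(fpsC a) -[phi1 (e 2 0)]/(fpsC b); ring.
by rewrite {1}Ebe; ring.
Qed.

Let phi0_const u : fps_deriv (phi0 u) = 0. Proof. exact: fps_derivC. Qed.

Let phi0_neq0 u : u != 0 -> fps_coef (phi0 u) 0 != 0.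
Proof. by rewrite -(inj_eq Theta_inj) rmorph0. Qed.

Let char0 n : n.+1%:R != 0 :> k.
Proof. by rewrite -(rmorph_nat psi) fmorph_eq0 pnatr_eq0. Qed.

Let fps_coef0M (f g : fps k) : fps_coef (f * g) 0 = fps_coef f 0 * fps_coef g 0.
Proof. by rewrite fps_coefM big_ord1. Qed.

Local Notation co h := (fps_coef h 0).
Let coef0_kernel (x v ct ca c12 c22 c21 c11 cb : fps k) :
  fps_coef (x * v - ct * (ca * v ^+ 2 + c12 * x * v ^+ 2 + c22 * x ^+ 2 * v ^+ 2
    + c21 * x ^+ 2 * v + c11 * x * v + cb * x ^+ 2)) 0 =
  co x * co v - co ct * (co ca * co v ^+ 2 + co c12 * co x * co v ^+ 2
    + co c22 * co x ^+ 2 * co v ^+ 2 + co c21 * co x ^+ 2 * co v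
    + co c11 * co x * co v + co cb * co x ^+ 2).
Proof.
by rewrite !expr2 !(fps_coefD, fps_coefN, fps_coef0M).
Qed.

Let Ker_rational (x v : fps k) :
  fps_rational x -> fps_rational v -> fps_rational (Ker x v).
Proof.
move=> xr vr; have cr r : fps_rational (phi1 r) by apply: fps_rationalC.
rewrite /Ker !expr2; do ?[exact: xr|exact: vr|exact: cr
  |apply: fps_rationalM|apply: fps_rationalN|apply: fps_rationalD].
Qed.

(* At s = 0 with x(0) = 0 the kernel takes the value - t a v(0)^2. *)
Let Ker_x0 (x v : fps k) : fps_coef x 0 = 0 -> fps_coef v 0 != 0 -> Ker x v != 0.
Proof.
move=> x_0 v_0; apply: contraNneq v_0 => /(congr1 (fun h => fps_coef h 0)).
rewrite /Ker coef0_kernel x_0 !(mul0r, mulr0, expr0n, addr0, sub0r) /=.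
move/eqP; rewrite oppr_eq0 !mulf_eq0 orbb.
have ct0 : (Theta (fpsC t) == 0) = false by have := fmorph_eq0 psi t; rewrite (negPf t0).
by have c0 : (Theta (fpsC (e 0 2)) == 0) = false := negbTE a0; rewrite ct0 c0.
Qed.

(* At s = 0 with v(0) = 0 the kernel takes the value - t b x(0)^2. *)
Let Ker_y0 (x v : fps k) : fps_coef v 0 = 0 -> fps_coef x 0 != 0 -> Ker x v != 0.
Proof.
move=> v_0 x_0; apply: contraNneq x_0 => /(congr1 (fun h => fps_coef h 0)).
rewrite /Ker coef0_kernel v_0 !(mul0r, mulr0, expr0n, add0r, sub0r) /=.
move/eqP; rewrite oppr_eq0 !mulf_eq0 orbb.
have ct0 : (Theta (fpsC t) == 0) = false by have := fmorph_eq0 psi t; rewrite (negPf t0).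
by have c0 : (Theta (fpsC (e 2 0)) == 0) = false := negbTE b0; rewrite ct0 c0.
Qed.

Let in_Qxyt_image (Phi : {rmorphism fps (fps R) -> fps k}) (Phi_inj : injective Phi) :
  fps_rational (Phi X) -> fps_rational (Phi Y) ->
  (forall r, fps_rational (Phi (c r))) ->
  forall h, in_Qxyt t h -> rational_image Phi_inj h.
Proof.
move=> PX PY Pc h [p [q [_ ->]]].
suff eval_image r : rational_image Phi_inj (eval_xyt t r).
  by apply: rational_image_div.
rewrite /eval_xyt /mmap; apply: big_ind => [||mon _]; first exact: rational_image0.
  exact: rational_imageD.
apply: rational_imageM; first exact/rational_image_tofrac/Pc.
rewrite /mmap1; apply: big_ind => [||i _]; first exact: rational_image1.
  exact: rational_imageM.
elim: (mon i) => [|n IHn]; first by rewrite expr0; apply: rational_image1.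
rewrite exprS; apply: rational_imageM => //.
by case: i {IHn} => -[|[|[|//]]] ?; apply: rational_image_tofrac => //; apply: Pc.
Qed.

Let alg_x1 : alg x1.
Proof. by apply: (alg_x (z' := x2)); rewrite ?xS ?opprK ?xP. Qed.
Let alg_x2 : alg x2.
Proof. by apply: (alg_x (z' := x1)); rewrite ?xS ?opprK ?xP 1?addrC // mulrAC. Qed.
Let alg_y1 : alg y1.
Proof. by apply: (alg_y (z' := y2)); rewrite ?yS ?opprK ?yP. Qed.
Let alg_y2 : alg y2.
Proof. by apply: (alg_y (z' := y1)); rewrite ?yS ?opprK ?yP 1?addrC // mulrAC. Qed.

(** The functional equation at (x(s), y(s)) and (x(s), y(rho s)) gives the
difference equation for f = t a y(s)^2 Q(0, y(s)). For the x-derivative the equation is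
then used at (x(s), Y) and for the y-derivative at (X, y(s)), where X and Y are
constants of k: these two points are not on the curve, so that the kernel does not
vanish and Q is an affine function of f. *)
Theorem walk_diff_transcendental :
  x_diff_transcendental t Q /\ y_diff_transcendental t Q.
Proof.
pose rho := b / (a * be ^+ 2).
have rho0 : rho != 0 := dilation_neq0 be_trans a0 b0.
have rho_inf : forall n, rho ^+ n.+1 != 1 :=
  dilation_infinite be_trans (alg_rat _) (alg_rat _) a0 b0.
have [x [y [m [z [[x_0 x_rat x'0] [y_0 y_rat y'0] kxy kxdy]]]]] :=
  kernel_uniformization be_trans
  (alg_rat _) (alg_rat _) alg_x1 alg_x2 alg_y1 alg_y2 a0 b0 (etrans (esym xP) yP) x10 x2y2.
rewrite -/rho in kxdy * => -[z0 b_rat b_z b_pos b_neg].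
have dy_0 : fps_coef (fps_dil rho y) 0 = 0 by rewrite coef_dil y_0 mul0r.
pose Fx := fps_comp_of phi1 x_0 F.
(* The functional equation at a zero (x, v) of the kernel. *)
have on_curve v (v_0 : fps_coef v 0 = 0) : Ker x v = 0 ->
    x * v = phi1 t * (phi1 (e 2 0) * x ^+ 2 * Fx
                      + phi1 (e 0 2) * v ^+ 2 * fps_comp_of phi1 v_0 G).
  move=> Kxv; pose inner : {rmorphism fps R -> fps k} := fps_comp_of phi1 v_0.
  have innerC r : inner (fpsC r) = phi1 r by apply: fps_compC.
  pose Phi : {rmorphism fps (fps R) -> fps k} := fps_comp_of inner x_0.
  have PhiX : Phi X = x by apply: fps_compX.
  have PhiC g : Phi (fpsC g) = inner g by apply: fps_compC.
  have innerX : inner (fpsX R) = v by apply: fps_compX.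
  have PhiF : Phi (embed_x F) = Fx by apply: eq_fps_comp => n; rewrite -innerC.
  have Phic r : Phi (c r) = phi1 r by rewrite PhiC innerC.
  have := image_functional_equation Phic.
  by rewrite PhiX !PhiC PhiF innerX Kxv mul0r => /esym/eqP; rewrite subr_eq0 => /eqP.
pose f := phi1 t * (phi1 (e 0 2) * y ^+ 2 * fps_comp_of phi1 y_0 G).
have fE : fps_dil rho f - f = x * (fps_dil rho y - y).
  have := on_curve _ dy_0 (Ker_vanishes kxdy).
  have := on_curve _ y_0 (Ker_vanishes kxy).
  have dil1 r : fps_dil rho (phi1 r) = phi1 r by apply: fps_dilC.
  have dilG : fps_dil rho (fps_comp_of phi1 y_0 G) = fps_comp_of phi1 dy_0 G.
    exact: fps_dil_comp.
  move=> E1 E2; rewrite mulrBr E1 E2 /f.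
  rewrite !(rmorphM (fps_dil rho)) /= !dil1 dilG.
  by move: (fps_comp_of phi1 dy_0 G) (fps_comp_of phi1 y_0 G) => G1 G2; ring.
have series_neq0 (u : fps k) : euler u != 0 -> u != 0.
  apply: contraNneq => ->; apply/eqP; apply: fpsP => n.
  by rewrite coef_euler !fps_coef0 mul0rn.
have phi1_rat r : fps_rational (phi1 r) by apply: fps_rationalC.
have phi0_rat h : fps_rational (phi0 h) by apply: fps_rationalC.
have one_rat : fps_rational (1 : fps k) by rewrite -(rmorph1 (@fpsC k)); apply: fps_rationalC.
have chain v (v_0 : fps_coef v 0 = 0) h : euler (fps_comp_of phi0 v_0 h) =
    fps_comp_of phi0 v_0 (fps_deriv h) * euler v.
  by rewrite /euler (@fps_deriv_comp _ _ phi0 v v_0 h phi0_const) mulrCA.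
have X0 : fpsX R != 0 by rewrite -poly_fpsX poly_fps_eq0 polyX_eq0.
split.
  (* Q(x(s), Y) is affine in f because t b x^2 Q(x, 0) = x y - f on the curve. *)
  pose Phi : {rmorphism fps (fps R) -> fps k} := fps_comp_of phi0 x_0.
  have Phi_inj : injective Phi.
    exact: (@fps_comp_inj _ _ phi0 x x_0 phi0_neq0 (series_neq0 x x'0)).
  have PhiX : Phi X = x by apply: fps_compX.
  have PhiC g : Phi (fpsC g) = phi0 g by apply: fps_compC.
  have PhiF : Phi (embed_x F) = Fx by apply: eq_fps_comp.
  have Phic r : Phi (c r) = phi1 r by rewrite PhiC.
  apply: (@transfer_diff_transcendental k _ Phi Phi_inj _ x _ (in_Qxyt t) rho f m z Q
    (Ker x (phi0 (fpsX R)))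
    (x * phi0 (fpsX R) - x * y - phi1 t * (phi1 (e 0 2) * phi0 (fpsX R) ^+ 2 * phi0 G)) 1).
  - exact: chain.
  - by apply: in_Qxyt_image => [||r]; rewrite ?PhiX ?PhiC ?Phic.
  - exact: char0.
  - exact: rho0.
  - exact: rho_inf.
  - exact: z0.
  - by rewrite fE.
  - by rewrite fE.
  - by rewrite fE.
  - by rewrite fE.
  - exact: x_rat.
  - exact: x'0.
  - exact: Ker_rational.
  - rewrite expr2; do ?[exact: x_rat|exact: y_rat|exact: phi1_rat|exact: phi0_rat
      |apply: fps_rationalM|apply: fps_rationalN|apply: fps_rationalD].
  - exact: one_rat.
  - by apply: Ker_x0 => //; apply: phi0_neq0.
  - exact: oner_neq0.
  have := image_functional_equation Phic.
  rewrite PhiX !PhiC PhiF => ->; have := on_curve _ y_0 (Ker_vanishes kxy).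
  by rewrite mul1r /f => ->; ring.
(* In Q(X, y(s)) the series f appears as it is; the transposition makes y the
outer variable. *)
pose Phi : {rmorphism fps (fps R) -> fps k} := fps_comp_of phi0 y_0 \o (@fps_tr R).
have Phi_inj : injective Phi.
  apply: inj_comp (can_inj (@fps_trK R)).
  exact: (@fps_comp_inj _ _ phi0 y y_0 phi0_neq0 (series_neq0 _ y'0)).
have tr_C g : fps_tr (fpsC g) = embed_x g.
  by apply: fpsP => i; apply: fpsP => -[|j].
have tr_embed g : fps_tr (embed_x g) = fpsC g.
  by rewrite -tr_C fps_trK.
have embed_X : embed_x (fpsX R) = X.
  by apply: fpsP => -[|[|i]]; apply: fpsP => -[|j].
have embed_C r : embed_x (fpsC r) = c r.
  by apply: fpsP => -[|i]; apply: fpsP => -[|j].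
have PhiX : Phi X = phi0 (fpsX R).
  by rewrite /Phi /= -embed_X tr_embed fps_compC.
have PhiE g : Phi (embed_x g) = phi0 g by rewrite /Phi /= tr_embed fps_compC.
have PhiY : Phi Y = y by rewrite /Phi /= tr_C embed_X fps_compX.
have Phic r : Phi (c r) = phi1 r by rewrite -embed_C PhiE.
have PhiG : Phi (fpsC G) = fps_comp_of phi1 y_0 G.
  by rewrite /Phi /= tr_C; apply: eq_fps_comp.
apply: (@transfer_diff_transcendental k _ Phi Phi_inj _ y _ (in_Qxyt t) rho f m z Q
  (Ker (phi0 (fpsX R)) y)
  (phi0 (fpsX R) * y - phi1 t * (phi1 (e 2 0) * phi0 (fpsX R) ^+ 2 * phi0 F)) (- 1)).
- by move=> h; rewrite /Phi /= chain -fps_tr_deriv.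
- by apply: in_Qxyt_image => [||r]; rewrite ?PhiX ?PhiY ?Phic.
- exact: char0.
- exact: rho0.
- exact: rho_inf.
- exact: z0.
- by rewrite fE.
- by rewrite fE.
- by rewrite fE.
- by rewrite fE.
- exact: y_rat.
- exact: y'0.
- exact: Ker_rational.
- rewrite expr2; do ?[exact: y_rat|exact: phi1_rat|exact: phi0_rat
    |apply: fps_rationalM|apply: fps_rationalN|apply: fps_rationalD].
- exact: fps_rationalN.
- by apply: Ker_y0 => //; apply: phi0_neq0.
- by rewrite oppr_eq0 oner_neq0.
have := image_functional_equation Phic.
by rewrite PhiX PhiY PhiE PhiG => ->; rewrite /f; ring.
Qed.

End WalkTranscendence.

(** * The five models *)

(** The roots z1 and z2 of z^2 - p z + q, labelled so that a vanishing root is z2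
unless both vanish. *)
Lemma closed_quadratic (C : closedFieldType) (p q : C) : exists z1 z2,
  [/\ z1 + z2 = p, z1 * z2 = q, (p != 0) || (q != 0) -> z1 != 0 & q = 0 -> z2 = 0].
Proof.
have [->|q0] := eqVneq q 0.
  by exists p, 0; rewrite addr0 mulr0 orbF; split.
have [z zE] := @GRing.solve_monicpoly C 2 (fun i => if i == 0%N then - q else p) isT.
have zq : z * (p - z) = q.
  move: zE; rewrite big_ord_recl big_ord1 /= expr0 expr1 mulr1 => zE.
  by rewrite mulrBr -expr2 zE [z * p]mulrC opprD opprK addrCA subrr addr0.
exists z, (p - z); split=> // [|_|/eqP]; last by rewrite (negPf q0).
  by rewrite addrC subrK.
by apply: contraNneq q0 => z0; rewrite -zq z0 mul0r.
Qed.

Lemma step_vec_inj : injective step_vec.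
Proof.
move=> [m n] [m' n'] [/addIr mE /addIr nE].
by congr (_, _); apply: val_inj; [case: mE | case: nE].
Qed.

Section Models.
Context (d : step -> rat).
Hypothesis dS : arises_from_S d.

Lemma mem_model s : (step_vec s \in model d) = (step_vec s != (0, 0)) && (d s != 0).
Proof.
by rewrite (mem_map step_vec_inj) mem_filter mem_enum andbT.
Qed.

(** The part of the condition on the model that the proof rests on, which computes
on each of the five sets. *)
Let checked (S : seq (int * int)) : bool :=
  [&& (-1, 1) \in S, (1, -1) \in S, ((0, 1) \in S) || ((1, 1) \in S),
      (-1, -1) \notin S, (-1, 0) \notin S & (0, -1) \notin S].

(** The steps (-1, 1) and (1, -1) are present, so is (0, 1) or (1, 1), which makes
x1 nonzero, and there is no step with negative sum of coordinates. *)
Lemma model_weights : [/\ d (inord 0, inord 2) != 0, d (inord 2, inord 0) != 0,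
  (d (inord 1, inord 2) != 0) || (d (inord 2, inord 2) != 0)
  & forall s : step, (s.1 + s.2 <= 1)%N -> d s = 0].
Proof.
have : checked (model d).
  have [S Sin SE] := dS; rewrite /checked !SE.
  by have /allP/(_ S Sin) : all checked models_S by [].
have vec m n : (m < 3)%N -> (n < 3)%N ->
    step_vec (inord m, inord n) = (m%:Z - 1, n%:Z - 1).
  by move=> m3 n3; rewrite /step_vec /= !inordK.
have mem m n (u : int * int) : (m < 3)%N -> (n < 3)%N -> u != (0, 0) ->
    u == (m%:Z - 1, n%:Z - 1) -> (u \in model d) = (d (inord m, inord n) != 0).
  by move=> m3 n3 u0 /eqP uE; rewrite uE -vec // mem_model vec // -uE u0.
rewrite /checked (mem 0%N 2%N) // (mem 2%N 0%N) // (mem 1%N 2%N) // (mem 2%N 2%N) //.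
rewrite (mem 0%N 0%N) // (mem 0%N 1%N) // (mem 1%N 0%N) //.
rewrite !negbK => /and5P[d02 d20 d12 /eqP d00 /andP[/eqP d01 /eqP d10]].
split=> // -[[m m3] [n n3]] /= mn.
have -> : (Ordinal m3, Ordinal n3) = (inord m, inord n) :> step.
  by congr (_, _); apply: val_inj; rewrite /= inordK.
by case: m n m3 n3 mn => [|[|m]] [|[|n]].
Qed.

End Models.

Theorem mainTheorem1 (R : realType) (t : R) (d : step -> rat) :
  0 < t < 1 -> ~ algebraicOver (ratr : rat -> R) t ->
  weights d -> arises_from_S d ->
  x_diff_transcendental t (walk_series d t) /\
  y_diff_transcendental t (walk_series d t).
Proof.
move=> t01 t_trans wd dS; have [d02 d20 d12 d_SW] := model_weights dS.
(* The constants are the fractions of C[[X]], C = R[i]: the series in the variable that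
is not substituted must embed, and the roots of three quadratic equations with real
coefficients are needed. *)
pose C : closedFieldType := complex R.
pose incl : {rmorphism R -> fps C} := @fpsC C \o (real_complex R).
have X00 : fps_coef (fpsX C) 0 = 0 by [].
pose k : fieldType := {fraction (fps C)}.
pose Theta : {rmorphism fps R -> k} := (@tofrac (fps C)) \o fps_comp_of incl X00.
pose emb : {rmorphism C -> k} := (@tofrac (fps C)) \o (@fpsC C).
have ThetaE r : Theta (fpsC r) = emb (real_complex R r).
  by rewrite /Theta /= fps_compC.
have Theta_inj : injective Theta.
  apply: inj_comp; first by move=> f g /eqP; rewrite tofrac_eq => /eqP.
  apply: fps_comp_inj => [r r0|]; last by rewrite -poly_fpsX poly_fps_eq0 polyX_eq0.
  by rewrite /incl /= fmorph_eq0.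
pose cst r : C := real_complex R r.
pose w m n := step_weight R d m n.
have w_neq0 m n : d (inord m, inord n) != 0 -> cst (w m n) != 0.
  by move=> dmn; rewrite /cst /w fmorph_eq0 /step_weight fmorph_eq0.
have a0 := w_neq0 _ _ d02; have b0 := w_neq0 _ _ d20.
have t0 : cst t != 0 by rewrite /cst fmorph_eq0 gt_eqF //; case/andP: t01.
have [x1 [x2 [xS xP x10 _]]] :=
  closed_quadratic (- cst (w 1 2) / cst (w 0 2)) (cst (w 2 2) / cst (w 0 2)).
have [y1 [y2 [yS yP _ y20]]] :=
  closed_quadratic (- cst (w 2 1) / cst (w 2 0)) (cst (w 2 2) / cst (w 2 0)).
have [be [be' [beS beP _ _]]] := closed_quadratic
  ((1 - cst t * cst (w 1 1)) / (cst t * cst (w 0 2))) (cst (w 2 0) / cst (w 0 2)).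
pose psi : {rmorphism R -> k} := Theta \o (@fpsC R).
have psiE r : psi r = emb (cst r) := ThetaE r.
apply: (@walk_diff_transcendental R d t k Theta wd t01 t_trans Theta_inj d_SW
  (emb be) (emb x1) (emb x2) (emb y1) (emb y2)).
- by rewrite /step_weight fmorph_eq0.
- by rewrite /step_weight fmorph_eq0.
- rewrite !psiE -(rmorphXn emb) -!(rmorphM emb, rmorphD emb); congr (emb _).
  have -> : be ^+ 2 = be * (be + be') - be * be' by ring.
  rewrite beS beP; move: (cst t) (cst (w 0 2)) (cst (w 1 1)) (cst (w 2 0)) t0 a0.
  by move=> t' a e11 b t'0 a'0; field; rewrite t'0 a'0.
- rewrite !psiE -(rmorphD emb) -(rmorphM emb) -(rmorphN emb); congr (emb _).
  by rewrite xS mulrCA divff // mulr1 opprK.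
- rewrite !psiE -!(rmorphM emb); congr (emb _).
  by rewrite -mulrA xP mulrCA divff // mulr1.
- rewrite !psiE -(rmorphD emb) -(rmorphM emb) -(rmorphN emb); congr (emb _).
  by rewrite yS mulrCA divff // mulr1 opprK.
- rewrite !psiE -!(rmorphM emb); congr (emb _).
  by rewrite -mulrA yP mulrCA divff // mulr1.
- rewrite fmorph_eq0; apply: x10.
  rewrite !mulf_eq0 !negb_or !invr_neq0 // !andbT oppr_eq0.
  by case/orP: d12 => /w_neq0 ->; rewrite ?orbT.
- move/eqP; rewrite fmorph_eq0 => /eqP x20.
  apply/eqP; rewrite fmorph_eq0; apply/eqP/y20.
  move/esym/eqP: xP; rewrite x20 mulr0 mulf_eq0 invr_eq0 (negPf a0) orbF => /eqP ->.
  by rewrite mul0r.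
Qed.
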